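(* Let $(a,b,c,d)$ be any one of the four quadruples $$(1,1,2,2),\ (1,2,2,2),\ (2,2,3,0),\ (2,3,4,0).$$ Then for every nonnegative integer $m$ there exist integers $x,y,z,t$ such that $m=x^{2}+y^{2}+z^{2}+t^{2}$ and $ax+by+cz+dt=k^{2}$ for some integer $k$. *)

(* Defs.v *)
From mathcomp Require Import all_boot all_order all_algebra.

(* Main.v *)
(* Let S = a^2 + b^2 + c^2 + d^2 and alpha = a + bi + cj + dk.  Solutions of the two equations
   correspond to quaternions beta = k^2 + ui + vj + wk of norm S m that are left multiples
   of alpha: one needs S m - k^4 = u^2 + v^2 + w^2 and four congruences mod S.  For the k used
   below most triples (u, v, w) satisfy the congruences after a permutation and changes of
   sign, by inspection of the residues mod S; the others do after the reflection orthogonal to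
   (1, 1, 1), which is integral for a suitable choice of signs unless
   u^2 + v^2 + w^2 = 1 mod 3.  A k between 1 and 6 with the right residues always exists if 16
   does not divide m and m is not too small.

   That n is a sum of three squares when n = 1, 2 mod 4 or n = 3 mod 8 is derived without
   Dirichlet's theorem.  Let theta = sum (-1)^t q^(t^2).  By Jacobi the coefficients of theta^4
   are divisor sums.  Kronecker's class number relation says that theta * g is the same series,
   where g has as n-th coefficient a signed count of the solutions of xy + yz + zx = n with
   x, y, z >= 0; hence g = theta^3.  Both Jacobi's theorem and the class number relation come
   from sums over the integer points of a quadric, cut into cones which are exchanged by
   automorphisms of the quadratic form. *)
Require Import Defs.
From mathcomp Require Import all_boot all_order all_algebra.
From mathcomp Require Import zify ring.
Import Order.TTheory.
Import GRing.Theory Num.Theory.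
Local Open Scope ring_scope.
Set Implicit Arguments.
Unset Strict Implicit.
Unset Printing Implicit Defensive.

(** * Finite sums over boxes of integers *)

(** Series are handled through sums over symmetric boxes [[-n, n]]. A box need not be stable under a
    change of variables: it is enough that it contains the supports involved, which is what
    [sum_reindex] and [sum_antisym] ask for. *)
Definition zbox (n : nat) : seq int := [seq i%:Z - n%:Z | i <- iota 0 n.*2.+1].
Arguments zbox n : simpl never.

Lemma mem_zbox n (x : int) : (x \in zbox n) = (`|x| <= n%:Z).
Proof.
apply/mapP/idP => [[i] | xn].
  by rewrite mem_iota => lei ->; lia.
by exists (absz (x + n%:Z)); [rewrite mem_iota | ]; lia.
Qed.

Lemma zbox_uniq n : uniq (zbox n).
Proof. by rewrite map_inj_uniq ?iota_uniq // => i j; lia. Qed.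

Lemma sum_supp (T : eqType) (s t : seq T) (F : T -> int) :
  uniq s -> uniq t -> (forall v, F v != 0 -> (v \in s) && (v \in t)) ->
  \sum_(v <- s) F v = \sum_(v <- t) F v.
Proof.
move=> s_uniq t_uniq suppF.
rewrite (bigID (fun v => F v != 0)) [RHS](bigID (fun v => F v != 0)) /=.
rewrite [X in _ + X]big1 => [|v]; last by rewrite negbK => /eqP.
rewrite [X in _ = _ + X]big1 => [|v]; last by rewrite negbK => /eqP.
congr (_ + _); rewrite -[LHS]big_filter -[RHS]big_filter; apply: perm_big.
apply: uniq_perm; rewrite ?filter_uniq // => v; rewrite !mem_filter.
by case: (boolP (F v != 0)) => //= /suppF/andP[-> ->].
Qed.

Lemma sum_reindex (T : eqType) (s : seq T) (F : T -> int) (f g : T -> T) :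
  uniq s -> cancel f g -> cancel g f ->
  (forall v, F v != 0 -> (v \in s) && (g v \in s)) ->
  \sum_(v <- s) F (f v) = \sum_(v <- s) F v.
Proof.
move=> s_uniq fK gK suppF; rewrite -(big_map f xpredT F).
apply/esym/sum_supp => //; first by rewrite map_inj_uniq //; apply: can_inj fK.
move=> v /suppF/andP[-> /=] /(map_f f).
by rewrite gK.
Qed.

Lemma sum_antisym (T : eqType) (s : seq T) (F : T -> int) (f : T -> T) :
  uniq s -> involutive f -> (forall v, F (f v) = - F v) ->
  (forall v, F v != 0 -> v \in s) ->
  \sum_(v <- s) F v = 0.
Proof.
move=> s_uniq fK Ff suppF.
have := sum_reindex (F := F) s_uniq fK fK.
rewrite (eq_bigr _ (fun v _ => Ff v)) sumrN => E.
suff: - (\sum_(v <- s) F v) = \sum_(v <- s) F v by lia.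
by apply: E => v Fv; rewrite !suppF // Ff oppr_eq0.
Qed.

Lemma sum_box_inv (T : eqType) (s : seq T) (F : T -> int) (f : T -> T) :
  uniq s -> involutive f -> (forall v, v \in s -> f v \in s) ->
  \sum_(v <- s) F (f v) = \sum_(v <- s) F v.
Proof.
move=> s_uniq fK fs; rewrite -(big_map f xpredT F); apply: perm_big.
apply: uniq_perm; rewrite ?map_inj_uniq //; first exact: inv_inj.
move=> v; apply/mapP/idP => [[w ws ->]|vs]; first exact: fs.
by exists (f v); rewrite ?fK ?fs.
Qed.

Lemma sum_zboxN n (F : int -> int) : \sum_(x <- zbox n) F (- x) = \sum_(x <- zbox n) F x.
Proof.
apply: sum_box_inv (zbox_uniq n) (@opprK _) _ => x.
by rewrite !mem_zbox normrN.
Qed.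

Lemma sum_zbox0 (F : int -> int) : \sum_(x <- zbox 0) F x = F 0.
Proof. by rewrite /zbox big_cons big_nil addr0. Qed.

Lemma sum_zboxS n (F : int -> int) :
  \sum_(x <- zbox n.+1) F x =
  F (- n.+1%:Z) + \sum_(x <- zbox n) F x + F n.+1%:Z.
Proof.
have -> : F (- n.+1%:Z) + \sum_(x <- zbox n) F x + F n.+1%:Z =
    \sum_(x <- [:: - n.+1%:Z, n.+1%:Z & zbox n]) F x.
  by rewrite !big_cons; ring.
apply: perm_big; apply: uniq_perm (zbox_uniq _) _ _.
  by rewrite 2!cons_uniq zbox_uniq andbT inE !mem_zbox; lia.
by move=> x; rewrite mem_zbox 2!in_cons mem_zbox; lia.
Qed.

Lemma sum_zbox1 n (F : int -> int) (a : int) :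
  `|a| <= n%:Z -> \sum_(x <- zbox n) (x == a)%:R * F x = F a.
Proof.
move=> an; rewrite (bigD1_seq a) ?mem_zbox ?zbox_uniq //= eqxx mul1r.
by rewrite big1 ?addr0 // => x /negbTE ->; rewrite mul0r.
Qed.

Definition box2 m n : seq (int * int) := [seq (x, y) | x <- zbox m, y <- zbox n].
Definition box3 m n : seq (int * int * int) := [seq (p, z) | p <- box2 m m, z <- zbox n].
Definition box4 m n : seq (int * int * int * int) :=
  [seq (p, t) | p <- box3 m m, t <- zbox n].

Lemma mem_box2 m n (x y : int) :
  ((x, y) \in box2 m n) = (`|x| <= m%:Z) && (`|y| <= n%:Z).
Proof.
rewrite -!mem_zbox.
by apply/allpairsPdep/andP => [[a [b [? ? [-> ->]]]]|[? ?]]; [|exists x, y].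
Qed.

Lemma mem_box3 m n (x y z : int) :
  ((x, y, z) \in box3 m n) = [&& `|x| <= m%:Z, `|y| <= m%:Z & `|z| <= n%:Z].
Proof.
rewrite andbA -mem_box2 -mem_zbox.
by apply/allpairsPdep/andP => [[a [b [? ? [-> ->]]]]|[? ?]]; [|exists (x, y), z].
Qed.

Lemma mem_box4 m n (x y z t : int) :
  ((x, y, z, t) \in box4 m n) =
  [&& `|x| <= m%:Z, `|y| <= m%:Z, `|z| <= m%:Z & `|t| <= n%:Z].
Proof.
have <- : ((x, y, z) \in box3 m m) && (t \in zbox n) =
  [&& `|x| <= m%:Z, `|y| <= m%:Z, `|z| <= m%:Z & `|t| <= n%:Z].
  by rewrite mem_box3 mem_zbox -!andbA.
by apply/allpairsPdep/andP => [[a [b [? ? [-> ->]]]]|[? ?]]; [|exists (x, y, z), t].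
Qed.

Lemma box2_uniq m n : uniq (box2 m n).
Proof. by apply: allpairs_uniq; rewrite ?zbox_uniq // => -[? ?] [? ?]. Qed.

Lemma box3_uniq m n : uniq (box3 m n).
Proof.
by apply: allpairs_uniq; rewrite ?zbox_uniq ?box2_uniq // => -[? ?] [? ?].
Qed.

Lemma box4_uniq m n : uniq (box4 m n).
Proof.
by apply: allpairs_uniq; rewrite ?zbox_uniq ?box3_uniq // => -[? ?] [? ?].
Qed.

Lemma sum_box2 m n (F : int * int -> int) :
  \sum_(v <- box2 m n) F v = \sum_(x <- zbox m) \sum_(y <- zbox n) F (x, y).
Proof. by rewrite big_allpairs_dep. Qed.

Lemma sum_box3 m n (F : int * int * int -> int) :
  \sum_(v <- box3 m n) F v =
  \sum_(x <- zbox m) \sum_(y <- zbox m) \sum_(z <- zbox n) F (x, y, z).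
Proof. by rewrite big_allpairs_dep big_allpairs_dep. Qed.

Lemma sum_box4 m n (F : int * int * int * int -> int) :
  \sum_(v <- box4 m n) F v =
  \sum_(x <- zbox m) \sum_(y <- zbox m) \sum_(z <- zbox m) \sum_(t <- zbox n)
    F (x, y, z, t).
Proof. by rewrite big_allpairs_dep sum_box3. Qed.

(** * Parity signs *)

Definition eps (x : int) : int := (-1) ^ x.

Lemma epsD x y : eps (x + y) = eps x * eps y.
Proof. exact: exprzDr. Qed.

Lemma eps0 : eps 0 = 1. Proof. by []. Qed.

Lemma eps1 : eps 1 = -1. Proof. by []. Qed.

Lemma epsN x : eps (- x) = eps x.
Proof. by rewrite /eps !expN1r abszN. Qed.

Lemma eps_sq x : eps x * eps x = 1.
Proof. by rewrite -{2}epsN -epsD subrr. Qed.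

Lemma eps_double x : eps (x + x) = 1.
Proof. by rewrite epsD eps_sq. Qed.

Lemma eps_neq0 x : eps x != 0.
Proof. by apply/eqP => E; have := eps_sq x; rewrite E. Qed.

Lemma eps_eq x y z : x - y = z + z -> eps x = eps y.
Proof. by move=> /(canRL (subrK _)) ->; rewrite epsD eps_double mul1r. Qed.

(** * Jacobi's four-square theorem *)

(** The coefficient of q^n in theta times the series with coefficients [a]. When [a] vanishes at
    negative arguments, the truncation is exact for [n <= K], since [t * t <= n] forces
    [|t| <= K]. *)
Definition theta (K : nat) (a : int -> int) (n : int) : int :=
  \sum_(t <- zbox K) eps t * a (n - t * t).

Fixpoint theta_pow (K k : nat) : int -> int :=
  if k is k'.+1 then theta K (theta_pow K k') else fun n => (n == 0)%:R.

Lemma theta_pow_neg K k (n : int) : n < 0 -> theta_pow K k n = 0.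
Proof.
elim: k n => [|k IHk] n n_lt0 /=; first by case: eqP n_lt0 => // ->.
rewrite /theta big1 // => t _; rewrite IHk ?mulr0 //.
by nia.
Qed.

Lemma theta_pow_at0 K k : theta_pow K k 0 = 1.
Proof.
elim: k => // k IHk /=; rewrite /theta (bigD1_seq 0) ?zbox_uniq ?mem_zbox //=.
rewrite big1 => [|t t0]; first by rewrite mul0r subr0 IHk eps0.
by rewrite theta_pow_neg ?mulr0 //; nia.
Qed.

(* n times the coefficient is the derivative q d/dq: Leibniz' rule for theta^(k+1). *)
Lemma theta_pow_deriv K k (n : int) :
  n * theta_pow K k.+1 n =
  k.+1%:Z * \sum_(t <- zbox K) eps t * (t * t) * theta_pow K k (n - t * t).
Proof.
elim: k n => [|k IHk] n.
  rewrite /= /theta mul1r mulr_sumr; apply: eq_bigr => t _.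
  case: eqP => [E|_]; last by rewrite !mulr0.
  have -> : n = t * t by lia.
  by rewrite !mulr1 mulrC.
pose Th := theta_pow K k.+1.
have -> : n * theta_pow K k.+2 n = \sum_(t <- zbox K) eps t * (t * t) * Th (n - t * t) +
   \sum_(t <- zbox K) eps t * ((n - t * t) * Th (n - t * t)).
  rewrite [theta_pow]lock /= -lock /theta mulr_sumr -big_split; apply: eq_bigr => t _ /=.
  by rewrite -/(Th _); ring.
have -> : k.+2%:Z = 1 + k.+1%:Z by lia.
rewrite mulrDl mul1r; congr (_ + _).
under eq_bigr => t _ do rewrite IHk mulrCA mulr_sumr.
rewrite -mulr_sumr exchange_big /=; congr (_ * _); apply: eq_bigr => t _.
rewrite /Th /= /theta mulr_sumr; apply: eq_bigr => u _.
have -> : n - t * t - u * u = n - u * u - t * t by ring.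
by ring.
Qed.

(** The n-th coefficient of theta^(k+1), multiplied by n, is computed both as that of theta times
    theta^k and by [theta_pow_deriv]. The term t = 0 carries the factor n, so the relation
    determines theta^k from its constant term. *)
Lemma theta_pow_rec K k (n : int) :
  \sum_(t <- zbox K) eps t * (n - k.+1%:Z * (t * t)) * theta_pow K k (n - t * t) = 0.
Proof.
have -> : \sum_(t <- zbox K) eps t * (n - k.+1%:Z * (t * t)) * theta_pow K k (n - t * t) =
    n * theta_pow K k.+1 n -
    k.+1%:Z * \sum_(t <- zbox K) eps t * (t * t) * theta_pow K k (n - t * t).
  rewrite [theta_pow]lock /= -lock /theta 2!mulr_sumr -sumrB; apply: eq_bigr => t _.
  by ring.
by rewrite theta_pow_deriv subrr.
Qed.

Lemma square_conv_eq0 (K : nat) (w : int -> int -> int) (a : int -> int) :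
  (forall n : int, n < 0 -> a n = 0) ->
  (forall n : int, 0 <= n <= K%:Z ->
     a n = 0 \/ w n 0 != 0 /\ \sum_(t <- zbox K) w n t * a (n - t * t) = 0) ->
  forall n : int, n <= K%:Z -> a n = 0.
Proof.
move=> a_neg a_rec n nK; case: (ltrP n 0) => [/a_neg //|n_ge0].
have [m Dm] : exists m : nat, n = m%:Z by exists (absz n); lia.
elim/ltn_ind: m n Dm nK {n_ge0} => m IHm n Dm nK.
have n_bounds : 0 <= n <= K%:Z by lia.
case: (a_rec n n_bounds) => // -[w0].
rewrite (bigD1_seq 0) ?zbox_uniq ?mem_zbox //= big1 => [|t t0].
  by rewrite mul0r subr0 addr0 => /eqP; rewrite mulf_eq0 (negbTE w0) => /eqP.
have t2 : 0 < t * t by nia.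
case: (ltrP (n - t * t) 0) => [/a_neg ->|ge0]; first by rewrite mulr0.
by rewrite (IHm (absz (n - t * t)%R)) ?mulr0 //; lia.
Qed.

(** For 0 < n <= K this is twice the sum of (-1)^(d + n/d) d over the divisors d of n. *)
Definition divsum (K : nat) (n : int) : int :=
  \sum_(p <- box2 K K)
    [&& 0 < p.1, 0 < p.2 & p.1 * p.2 == n]%:R * eps (p.1 + p.2) * (p.1 + p.2).

Definition jacobi_term (N : int) (H : int -> int -> int -> int) (p : int * int * int) : int :=
  let: (v, w, u) := p in
  [&& 0 < v, 0 < w & u * u + v * w == N]%:R * eps (u + v + w) * H v w u.

Definition jacobi_sum (K : nat) N H := \sum_(p <- box3 K K) jacobi_term N H p.

Lemma jacobi_term_supp (K : nat) (N : int) H p :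
  N <= K%:Z -> jacobi_term N H p != 0 -> p \in box3 K K.
Proof.
case: p => [[v w] u] NK /=; case: and3P => [[v0 w0 /eqP E] _|_]; last by rewrite !mul0r.
by rewrite mem_box3; apply/and3P; split; nia.
Qed.

Lemma jacobi_sum_reindex (K : nat) (N : int) H H' f :
  N <= K%:Z -> involutive f ->
  (forall p, jacobi_term N H (f p) = jacobi_term N H' p) ->
  jacobi_sum K N H = jacobi_sum K N H'.
Proof.
move=> NK fK HH'; rewrite /jacobi_sum -(sum_reindex (box3_uniq K K) fK fK).
  exact: eq_bigr.
move=> v Fv; rewrite (jacobi_term_supp NK Fv) /= (jacobi_term_supp (H := H') NK) //.
by rewrite -HH' fK.
Qed.

Lemma jacobi_sumD K (N : int) (H H' : int -> int -> int -> int) :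
  jacobi_sum K N (fun v w u => H v w u + H' v w u) = jacobi_sum K N H + jacobi_sum K N H'.
Proof.
by rewrite /jacobi_sum -big_split; apply: eq_bigr => -[[v w] u] _ /=; rewrite mulrDr.
Qed.

Lemma jacobi_sumZ K (N c : int) (H : int -> int -> int -> int) :
  jacobi_sum K N (fun v w u => c * H v w u) = c * jacobi_sum K N H.
Proof.
by rewrite /jacobi_sum mulr_sumr; apply: eq_bigr => -[[v w] u] _ /=; rewrite mulrCA.
Qed.

Lemma eq_jacobi_sum K (N : int) (H H' : int -> int -> int -> int) :
  (forall v w u, 0 < v -> 0 < w -> u * u + v * w = N -> H v w u = H' v w u) ->
  jacobi_sum K N H = jacobi_sum K N H'.
Proof.
move=> HH'; apply: eq_bigr => -[[v w] u] _ /=.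
by case: and3P => [[v0 w0 /eqP E]|]; rewrite ?mul0r // HH'.
Qed.

Lemma jacobi_sumNu (K : nat) (N : int) (H : int -> int -> int -> int) : N <= K%:Z ->
  jacobi_sum K N (fun v w u => H v w (- u)) = jacobi_sum K N H.
Proof.
move=> NK; apply: (jacobi_sum_reindex (f := fun p => (p.1.1, p.1.2, - p.2))) NK _ _.
  by case=> [[v w] u] /=; rewrite opprK.
case=> [[v w] u] /=; rewrite opprK mulrNN; congr (_ * _ * _).
by apply: (@eps_eq _ _ (- u)); ring.
Qed.

Lemma jacobi_sum_swap (K : nat) (N : int) (H : int -> int -> int -> int) : N <= K%:Z ->
  jacobi_sum K N (fun v w u => H w v u) = jacobi_sum K N H.
Proof.
move=> NK; apply: (jacobi_sum_reindex (f := fun p => (p.1.2, p.1.1, p.2))) NK _ _.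
  by case=> [[v w] u].
case=> [[v w] u] /=; rewrite andbCA [w * v]mulrC; congr (_ * _ * _).
by congr eps; ring.
Qed.

(* (v, w, u) |-> (v + 2u - w, w, w - u) preserves u^2 + vw and exchanges v with
   v + 2u - w. *)
Lemma jacobi_sum_flip (K : nat) (N : int) (H : int -> int -> int -> int) : N <= K%:Z ->
  jacobi_sum K N (fun v w u => (0 < v + 2 * u - w)%R%:R * H (v + 2 * u - w) w (w - u)) =
  jacobi_sum K N (fun v w u => (0 < v + 2 * u - w)%R%:R * H v w u).
Proof.
move=> NK.
apply: (jacobi_sum_reindex (f := fun p => (p.1.1 + 2 * p.2 - p.1.2, p.1.2, p.1.2 - p.2))) NK _ _.
  by case=> [[v w] u] /=; congr (_, _, _); ring.
case=> [[v w] u] /=.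
have -> : v + 2 * u - w + 2 * (w - u) - w = v by ring.
have -> : (w - u) * (w - u) + (v + 2 * u - w) * w = u * u + v * w by ring.
have -> : w - (w - u) = u by ring.
have -> : eps (w - u + (v + 2 * u - w) + w) = eps (u + v + w).
  by congr eps; ring.
by case: (0 < v)%R; case: (0 < v + 2 * u - w)%R; rewrite /= ?mul0r ?mulr0 ?mul0r ?mulr0.
Qed.

Lemma sum_eps s : \sum_(u <- zbox s) eps u = eps s%:Z.
Proof.
elim: s => [|s IHs]; first by rewrite sum_zbox0.
rewrite sum_zboxS IHs epsN.
have -> : eps s.+1%:Z = - eps s%:Z by rewrite -addn1 PoszD epsD eps1 mulrN1.
by ring.
Qed.

Lemma sum_eps_square s :
  \sum_(u <- zbox s) eps u * (s%:Z * s%:Z - u * u) = - eps s%:Z * s%:Z.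
Proof.
elim: s => [|s IHs]; first by rewrite sum_zbox0.
rewrite sum_zboxS epsN.
have -> : eps s.+1%:Z = - eps s%:Z by rewrite -addn1 PoszD epsD eps1 mulrN1.
rewrite (eq_bigr (fun u => eps u * (s%:Z * s%:Z - u * u) + eps u * (2 * s%:Z + 1))).
  rewrite big_split -mulr_suml IHs sum_eps /=.
  have -> : s.+1%:Z = s%:Z + 1 by lia.
  by ring.
move=> u _; have -> : s.+1%:Z = s%:Z + 1 by lia.
by ring.
Qed.

(** The automorphism of [jacobi_sum_flip] carries [jacobi_k] to [jacobi_c] and negates
    [jacobi_k w v (- u)], while [jacobi_c] is invariant under (v, w, u) |-> (w, v, -u). *)
Definition jacobi_k (v w u : int) : int := (v + 2 * u) * ((w - u) * (w - u)).
Definition jacobi_c (v w u : int) : int := (v + w) * (u * u).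

(** The symmetry (v, w, u) |-> (w, v, -u) carries the cone v + 2u < w to the cone v + 2u > w, where
    [jacobi_sum_flip] acts. *)
Lemma jacobi_sum_trichotomy (K : nat) (N : int) (H : int -> int -> int -> int) :
  N <= K%:Z ->
  jacobi_sum K N H =
  jacobi_sum K N (fun v w u => (0 < v + 2 * u - w)%R%:R * H v w u) +
  jacobi_sum K N (fun v w u => (0 < v + 2 * u - w)%R%:R * H w v (- u)) +
  jacobi_sum K N (fun v w u => (v + 2 * u - w == 0)%:R * H v w u).
Proof.
move=> NK.
have -> : jacobi_sum K N (fun v w u => (0 < v + 2 * u - w)%R%:R * H w v (- u)) =
    jacobi_sum K N (fun v w u => (v + 2 * u - w < 0)%R%:R * H v w u).
  rewrite -jacobi_sum_swap // -jacobi_sumNu //; apply: eq_jacobi_sum => v w u _ _ _.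
  by rewrite opprK; congr (_%:R * _); lia.
rewrite -!jacobi_sumD; apply: eq_jacobi_sum => v w u _ _ _.
by case: (ltrgtP 0 (v + 2 * u - w)) => _; rewrite !(mul0r, mul1r, addr0, add0r).
Qed.

(** In the cone v + 2u > w the weight [2 * jacobi_k - jacobi_c] contributes the sum of [jacobi_c],
    and in the opposite cone the negative of the same sum. Only the wall v + 2u = w survives. *)
Lemma jacobi_sum_diag (K : nat) (N : int) : N <= K%:Z ->
  jacobi_sum K N (fun v w u => (v + w) * (v * w - 4 * (u * u))) =
  jacobi_sum K N (fun v w u =>
    (v + 2 * u - w == 0)%:R * (2 * jacobi_k v w u - jacobi_c v w u)).
Proof.
move=> NK; pose h v w u := 2 * jacobi_k v w u - jacobi_c v w u.
have -> : jacobi_sum K N (fun v w u => (v + w) * (v * w - 4 * (u * u))) =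
    jacobi_sum K N h.
  suff: 4 * jacobi_sum K N (fun v w u => (v + w) * (v * w - 4 * (u * u))) =
    4 * jacobi_sum K N h by lia.
  (* The left-hand weight is the average of [h] over the four symmetries generated by u |-> -u and
     the exchange of v and w. *)
  rewrite -jacobi_sumZ.
  have -> : 4 * jacobi_sum K N h =
     jacobi_sum K N h + jacobi_sum K N (fun v w u => h v w (- u)) +
    (jacobi_sum K N (fun v w u => h w v u) + jacobi_sum K N (fun v w u => h w v (- u))).
    rewrite (jacobi_sum_swap h) // (jacobi_sum_swap (fun v w u => h v w (- u))) //.
    by rewrite jacobi_sumNu //; ring.
  rewrite -!jacobi_sumD; apply: eq_jacobi_sum => v w u _ _ _.
  by rewrite /h /jacobi_k /jacobi_c; ring.
have k_pos : jacobi_sum K N (fun v w u => (0 < v + 2 * u - w)%R%:R * jacobi_k v w u) =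
    jacobi_sum K N (fun v w u => (0 < v + 2 * u - w)%R%:R * jacobi_c v w u).
  rewrite -jacobi_sum_flip //; apply: eq_jacobi_sum => v w u _ _ _.
  by congr (_ * _); rewrite /jacobi_k /jacobi_c; ring.
have k_neg : jacobi_sum K N (fun v w u => (0 < v + 2 * u - w)%R%:R * jacobi_k w v (- u)) = 0.
  set s := jacobi_sum _ _ _; suff: s = (-1) * s by lia.
  rewrite {1}/s -jacobi_sum_flip // -jacobi_sumZ; apply: eq_jacobi_sum => v w u _ _ _.
  by rewrite /jacobi_k; ring.
have c_neg : jacobi_sum K N (fun v w u => (0 < v + 2 * u - w)%R%:R * jacobi_c w v (- u)) =
    jacobi_sum K N (fun v w u => (0 < v + 2 * u - w)%R%:R * jacobi_c v w u).
  by apply: eq_jacobi_sum => v w u _ _ _; rewrite /jacobi_c; ring.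
have splitD (H : int -> int -> int -> int) :
    jacobi_sum K N (fun v w u => H v w u * h v w u) =
    2 * jacobi_sum K N (fun v w u => H v w u * jacobi_k v w u) -
    jacobi_sum K N (fun v w u => H v w u * jacobi_c v w u).
  rewrite -mulN1r -!jacobi_sumZ -jacobi_sumD; apply: eq_jacobi_sum => v w u _ _ _.
  by rewrite /h; ring.
have -> : jacobi_sum K N h = 2 * jacobi_sum K N jacobi_k - jacobi_sum K N jacobi_c.
  rewrite -mulN1r -!jacobi_sumZ -jacobi_sumD; apply: eq_jacobi_sum => v w u _ _ _.
  by rewrite /h; ring.
rewrite splitD (jacobi_sum_trichotomy jacobi_k) // (jacobi_sum_trichotomy jacobi_c) //.
by rewrite k_pos k_neg c_neg; ring.
Qed.

(** On the wall w = v + 2u one has u^2 + vw = (u + v)^2, so v = s - u and w = s + u with |u| < s,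
    and a sum over u alone remains. *)
Lemma jacobi_sum_diag_eval (K s : nat) : (0 < s)%N -> (s * s <= K)%N ->
  jacobi_sum K (s%:Z * s%:Z) (fun v w u =>
    (v + 2 * u - w == 0)%:R * (2 * jacobi_k v w u - jacobi_c v w u)) =
  - (2 * (s%:Z * s%:Z) * eps s%:Z).
Proof.
move=> s_gt0 sK; pose S := s%:Z.
(* The weight at v = S - u, w = S + u, split into its even and odd parts in u; the odd part sums to
   0. *)
pose c u := (`|u| < S)%R%:R * eps u * (2 * S * (S * S - u * u)) +
            (`|u| < S)%R%:R * eps u * (2 * (S * S) * u).
transitivity (\sum_(u <- zbox K) c u).
  rewrite /jacobi_sum sum_box3.
  under eq_bigr => v _ do rewrite exchange_big /=.
  rewrite exchange_big /=; apply: eq_big_seq => u; rewrite mem_zbox => uK.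
  transitivity (\sum_(v <- zbox K) (v == S - u)%:R *
      \sum_(w <- zbox K) (w == S + u)%:R * c u).
    apply: eq_bigr => v _; rewrite mulr_sumr; apply: eq_bigr => w _ /=.
    rewrite [RHS]mulrA -natrM mulnb.
    case: (boolP ((v == S - u) && (w == S + u))) => [/andP[/eqP -> /eqP ->]|].
      have -> : S - u + 2 * u - (S + u) == 0 by apply/eqP; ring.
      have -> : u * u + (S - u) * (S + u) == S * S by apply/eqP; ring.
      have -> : eps (u + (S - u) + (S + u)) = eps u by apply: (@eps_eq _ _ S); ring.
      rewrite andbT /c /jacobi_k /jacobi_c.
      have -> : (0 < S - u) && (0 < S + u) = (`|u| < S) by lia.
      by ring.
    move=> vw_neq; rewrite mul0r.
    case: and3P => [[v0 w0 /eqP E]|]; last by rewrite !mul0r.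
    case: eqP => [q0|]; last by rewrite mul0r mulr0.
    by move: vw_neq; rewrite /S; nia.
  rewrite /c; case: (boolP (`|u| < S)) => [u_lt|_].
    by rewrite (@sum_zbox1 _ (fun=> _)) ?(@sum_zbox1 _ (fun=> _)) //; nia.
  rewrite !mul0r add0r big1 // => v _.
  by rewrite big1 ?mulr0 // => w _; rewrite mulr0.
rewrite big_split /= [X in _ + X](_ : _ = 0) ?addr0; last first.
  set X := (X in X = 0); suff: X = - X by lia.
  rewrite {1}/X -sum_zboxN -sumrN; apply: eq_bigr => u _.
  by rewrite normrN epsN; ring.
have := sum_eps_square s; rewrite -/S => sq.
transitivity (2 * S * (- eps S * S)); last by ring.
rewrite -sq mulr_sumr.
(* The summand vanishes at |u| = S, so the endpoints may be included. *)
transitivity (\sum_(u <- zbox K) (`|u| <= S)%R%:R * (2 * S * (eps u * (S * S - u * u)))).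
  apply: eq_bigr => u _; case: (ltrgtP `|u| S) => [_|_|uS]; [by rewrite !mul1r; ring | by rewrite !mul0r |].
  have -> : u * u = S * S by nia.
  by ring.
transitivity (\sum_(u <- zbox s) (`|u| <= S)%R%:R * (2 * S * (eps u * (S * S - u * u)))).
  apply: sum_supp (zbox_uniq _) (zbox_uniq _) _ => u; rewrite !mem_zbox -/S.
  by case: (boolP (`|u| <= S)) => [uS _|_]; rewrite ?mul0r ?eqxx //=; nia.
by apply: eq_big_seq => u; rewrite mem_zbox => ->; rewrite mul1r.
Qed.

(* (-1)^n r_4(n), where r_4(n) counts the representations of n by four squares. *)
Definition jacobi_coef (K : nat) (n : int) : int := (n == 0)%:R - 4 * divsum K n.

Lemma jacobi_sum_conv (K : nat) (N : int) :
  \sum_(u <- zbox K) eps u * (N - 5 * (u * u)) * divsum K (N - u * u) =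
  jacobi_sum K N (fun v w u => (v + w) * (v * w - 4 * (u * u))).
Proof.
rewrite /jacobi_sum sum_box3.
under [RHS]eq_bigr => v _ do rewrite exchange_big /=.
rewrite [RHS]exchange_big /=; apply: eq_bigr => u _.
rewrite /divsum sum_box2 mulr_sumr; apply: eq_bigr => v _.
rewrite mulr_sumr; apply: eq_bigr => w _ /=.
have -> : (v * w == N - u * u) = (u * u + v * w == N) by lia.
case: and3P => [[_ _ /eqP <-]|]; last by rewrite !mul0r mulr0.
by rewrite -addrA !epsD; ring.
Qed.

Lemma jacobi_coef_rec (K : nat) (N : int) : 0 < N <= K%:Z ->
  \sum_(u <- zbox K) eps u * (N - 5 * (u * u)) * jacobi_coef K (N - u * u) = 0.
Proof.
case/andP=> N0 NK.
have -> : \sum_(u <- zbox K) eps u * (N - 5 * (u * u)) * jacobi_coef K (N - u * u) =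
  \sum_(u <- zbox K) (N - u * u == 0)%:R * (eps u * (N - 5 * (u * u))) -
  4 * \sum_(u <- zbox K) eps u * (N - 5 * (u * u)) * divsum K (N - u * u).
  by rewrite mulr_sumr -sumrB; apply: eq_bigr => u _; rewrite /jacobi_coef; ring.
rewrite jacobi_sum_conv jacobi_sum_diag //.
(* If N = s^2, then u = s and u = -s together contribute -8 s^2 (-1)^s, which cancels -4 times the
   wall sum; otherwise both parts are 0. *)
case: (boolP (has (fun u : int => u * u == N) (zbox K))) => [|/hasPn nsq].
  case/hasP=> u uK /eqP uN; pose s := absz u.
  have sN : s%:Z * s%:Z = N by rewrite /s; lia.
  rewrite -sN jacobi_sum_diag_eval; [|lia|lia].
  rewrite (eq_bigr (fun u => (u == s%:Z)%:R * (eps u * (s%:Z * s%:Z - 5 * (u * u))) +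
             (u == - s%:Z)%:R * (eps u * (s%:Z * s%:Z - 5 * (u * u))))); last first.
    move=> x _; rewrite -mulrDl; congr (_ * _).
    case: (x =P s%:Z) => [->|xs].
      have /negbTE -> : s%:Z != - s%:Z by lia.
      by rewrite subrr.
    case: (x =P - s%:Z) => [->|xns]; first by rewrite mulrNN subrr.
    by case: eqP => // E; nia.
  rewrite big_split !sum_zbox1 /= ?epsN; [ring|nia|nia].
rewrite big1_seq => [|u /nsq]; last by rewrite -subr_eq0 -opprB oppr_eq0 => /negbTE ->; rewrite mul0r.
rewrite /jacobi_sum big1 ?mulr0 ?subr0 // => -[[v w] u] _ /=.
case: and3P => [[v0 w0 /eqP E]|]; last by rewrite !mul0r.
case: eqP => [q0|]; last by rewrite mul0r mulr0.
have: u + v \in zbox K by rewrite mem_zbox; nia.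
by move/nsq; nia.
Qed.

(* Jacobi: both sides satisfy the recurrence obtained by differentiating theta^5. *)
Lemma theta_pow4 (K : nat) (n : int) : n <= K%:Z -> theta_pow K 4 n = jacobi_coef K n.
Proof.
have divsum_le0 m : m <= 0 -> divsum K m = 0.
  move=> m_le0; rewrite /divsum big1 // => -[v w] _ /=.
  by case: and3P => [[v0 w0 /eqP E]|]; rewrite ?mul0r //; nia.
move=> nK; apply/eqP; rewrite -subr_eq0; apply/eqP.
pose a n := theta_pow K 4 n - jacobi_coef K n; rewrite -/(a n).
apply: (square_conv_eq0 (K := K) (w := fun n t => eps t * (n - 5 * (t * t)))) nK.
  move=> m m0; rewrite /a theta_pow_neg // /jacobi_coef divsum_le0; last by lia.
  by have /negbTE -> : m != 0 by lia.
move=> m /andP[m_ge0 mK]; case: (eqVneq m 0) => [->|m0]; [left|right].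
  by rewrite /a theta_pow_at0 /jacobi_coef divsum_le0.
split; first by rewrite mul0r mulr0 subr0 mul1r.
under eq_bigr => t _ do rewrite /a mulrBr.
by rewrite sumrB theta_pow_rec jacobi_coef_rec ?subrr //; lia.
Qed.

(** * The class number relation *)

Notation sg := (Num.sg : int -> int).

(** A degenerate form of the addition formula for tanh, with a correction at a = b = 0. *)
Lemma sgM_add (a b : int) :
  sg a * sg b = sg (a + b) * (sg a + sg b) - 1 + ((a == 0) && (b == 0))%:R.
Proof. by case: (sgrP a); case: (sgrP b); case: (sgrP (a + b)); lia. Qed.

(** Symmetric truncation gives the value 0 to an alternating sum with infinite support. By oddness
    it holds at x = 0, and a unit shift of x changes the sum by two terms at consecutive z, which
    cancel. *)
Lemma sum_eps_sg (M : nat) (x : int) : `|x| <= M%:Z ->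
  \sum_(z <- zbox M) eps z * sg (x + z) = 0.
Proof.
have nonneg (n : nat) : (n <= M)%N -> \sum_(z <- zbox M) eps z * sg (n%:Z + z) = 0.
  elim: n => [|n IHn] nM.
    set X := (X in X = 0); suff: X = - X by lia.
    rewrite {1}/X -sum_zboxN -sumrN; apply: eq_bigr => z _.
    by rewrite epsN !add0r sgrN mulrN.
  rewrite (eq_bigr (fun z => eps z * sg (n%:Z + z) +
     ((z == - n%:Z)%:R * eps z + (z == - n.+1%:Z)%:R * eps z))); last first.
    move=> z _; have -> : sg (n.+1%:Z + z) = sg (n%:Z + z) + ((z == - n%:Z)%:R + (z == - n.+1%:Z)%:R).
      by lia.
    by ring.
  rewrite !big_split /= IHn ?(ltnW nM) // !sum_zbox1; [|lia|lia].
  by rewrite !epsN -addn1 PoszD epsD eps1; ring.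
move=> xM; case: (lerP 0 x) => x0.
  by have := @nonneg (absz x); rewrite gez0_abs //; apply; lia.
rewrite -sum_zboxN -[RHS]oppr0 -[X in - X](@nonneg (absz x)); last by lia.
rewrite -sumrN; apply: eq_bigr => z _; rewrite epsN -mulrN -sgrN.
by congr (_ * sg _); lia.
Qed.

(** Summing over t turns the sign of a linear form back into a linear weight; this is how divisor
    sums arise from signs. *)
Lemma sum_sg_double (K : nat) (c : int) : `|c| <= 2 * K%:Z ->
  \sum_(t <- zbox K) sg (c + 2 * t) = c.
Proof.
have nonneg (n : nat) : (n <= K.*2)%N -> \sum_(t <- zbox K) sg (n%:Z + 2 * t) = n%:Z.
  elim: n => [|n IHn] nK.
    set X := (X in X = _); suff: X = - X by lia.
    rewrite {1}/X -sum_zboxN -sumrN; apply: eq_bigr => t _.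
    by rewrite !add0r mulrN sgrN.
  rewrite (eq_bigr (fun t => sg (n%:Z + 2 * t) + (t == - (n.+1)./2%:Z)%:R * 1)).
    by rewrite big_split /= IHn ?(ltnW nK) // sum_zbox1; lia.
  by move=> t _; rewrite mulr1; lia.
move=> cK; case: (lerP 0 c) => c0.
  by have := @nonneg (absz c); rewrite gez0_abs //; apply; lia.
rewrite -sum_zboxN; have := @nonneg (absz c).
have -> : (absz c)%:Z = - c by lia.
move=> E; rewrite -[RHS]opprK -E; last by lia.
by rewrite -sumrN; apply: eq_bigr => t _; rewrite -sgrN; congr sg; ring.
Qed.

(* Twice the weight of a solution of xy + yz + zx = n: 4 if x, y, z have the same sign,
   2 if one of them is 0 and the others have the same sign, -2 at the origin, else 0. *)
Definition dom (x y z : int) : int :=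
  1 + sg x * sg y + sg y * sg z + sg z * sg x -
  (((x == 0) && (y == 0))%:R + ((y == 0) && (z == 0))%:R + ((z == 0) && (x == 0))%:R).

(** The first factor is unchanged and the second negated by the automorphism used in
    [quad_sum_edge]. The second factor is 0 when |t| < |x|. *)
Definition edge_wt (x y z t : int) : int :=
  (sg (x + y) + sg (x + z)) * (2 * sg x - sg (x + t) - sg (x - t)).

Definition face_wt (x y z t : int) : int :=
  (sg (x + t) + sg (z + t)) * (sg (y - t) + sg (x + z)).

(* The weights are sums of products of signs of linear forms, which sgM_add linearizes. *)
Lemma dom_decomp (x y z t : int) : 0 < x * y + y * z + z * x + t * t ->
  2 * dom x y z =
  edge_wt x y z t + edge_wt y x z t + edge_wt z y x t +
  face_wt x y z t + face_wt x y z (- t).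
Proof.
move=> Q_gt0.
have sgM_pair (a b c : int) : (a == 0) && (b == 0) = false -> a + b = c ->
    sg a * sg b = sg c * (sg a + sg b) - 1.
  by move=> ab0 <-; rewrite sgM_add ab0 addr0.
have face (u : int) : u * u = t * t -> face_wt x y z u =
    sg (x + y) * (sg (x + u) + sg (y - u)) + sg (y + z) * (sg (z + u) + sg (y - u)) +
    sg (x + z) * (sg (x + u) + sg (z + u)) - 2.
  move=> uu; rewrite /face_wt mulrDl !mulrDr.
  (* If both forms vanished, the quadratic form would be 0; hence the correction term of [sgM_add]
     is absent. *)
  have xy_face : (x + u == 0) && (y - u == 0) = false.
    apply/negP => /andP[/eqP xu /eqP yu].
    have [Dx Dy] : x = - u /\ y = u by lia.
    by move: Q_gt0; rewrite Dx Dy -uu; nia.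
  have yz_face : (z + u == 0) && (y - u == 0) = false.
    apply/negP => /andP[/eqP zu /eqP yu].
    have [Dz Dy] : z = - u /\ y = u by lia.
    by move: Q_gt0; rewrite Dz Dy -uu; nia.
  rewrite (sgM_pair _ _ (x + y) xy_face) ?(sgM_pair _ _ (y + z) yz_face); [|ring|ring].
  by ring.
rewrite !face ?mulrNN // /dom /edge_wt (sgM_add x y) (sgM_add y z) (sgM_add z x).
rewrite (addrC y x) (addrC z y) (addrC z x) opprK.
by ring.
Qed.

(** * Sums over the quadric xy + yz + zx + t^2 = N *)

Definition quad_sum (M K : nat) (N : int) (H : int -> int -> int -> int -> int) : int :=
  \sum_(p <- box4 M K) let: (x, y, z, t) := p in
    (x * y + y * z + z * x + t * t == N)%:R * eps (x + y + z + t) * H x y z t.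

Lemma quad_sumD M K (N : int) (H H' : int -> int -> int -> int -> int) :
  quad_sum M K N (fun x y z t => H x y z t + H' x y z t) =
  quad_sum M K N H + quad_sum M K N H'.
Proof.
by rewrite -big_split; apply: eq_bigr => -[[[x y] z] t] _ /=; rewrite mulrDr.
Qed.

Lemma quad_sumZ M K (N c : int) (H : int -> int -> int -> int -> int) :
  quad_sum M K N (fun x y z t => c * H x y z t) = c * quad_sum M K N H.
Proof.
by rewrite mulr_sumr; apply: eq_bigr => -[[[x y] z] t] _ /=; rewrite mulrCA.
Qed.

Lemma eq_quad_sum M K (N : int) (H H' : int -> int -> int -> int -> int) :
  (forall x y z t, x * y + y * z + z * x + t * t = N -> H x y z t = H' x y z t) ->
  quad_sum M K N H = quad_sum M K N H'.
Proof.
move=> HH'; apply: eq_bigr => -[[[x y] z] t] _.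
by case: eqP => [/HH' ->|]; rewrite ?mul0r.
Qed.

Lemma quad_sum_xy M K (N : int) (H : int -> int -> int -> int -> int) :
  quad_sum M K N (fun x y z t => H y x z t) = quad_sum M K N H.
Proof.
rewrite -[RHS](@sum_box_inv _ _ _ (fun p => (p.1.1.2, p.1.1.1, p.1.2, p.2))) ?box4_uniq //.
- apply: eq_bigr => -[[[x y] z] t] _ /=.
  have -> : y * x + x * z + z * y = x * y + y * z + z * x by ring.
  by rewrite (addrC y x).
- by case=> [[[x y] z] t].
- by case=> [[[x y] z] t]; rewrite !mem_box4 => /and4P[-> -> -> /=]; rewrite ?normrN.
Qed.

Lemma quad_sum_yz M K (N : int) (H : int -> int -> int -> int -> int) :
  quad_sum M K N (fun x y z t => H x z y t) = quad_sum M K N H.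
Proof.
rewrite -[RHS](@sum_box_inv _ _ _ (fun p => (p.1.1.1, p.1.2, p.1.1.2, p.2))) ?box4_uniq //.
- apply: eq_bigr => -[[[x y] z] t] _ /=.
  have -> : x * z + z * y + y * x = x * y + y * z + z * x by ring.
  by rewrite (addrAC x z y).
- by case=> [[[x y] z] t].
- by case=> [[[x y] z] t]; rewrite !mem_box4 => /and4P[-> -> -> /=]; rewrite ?normrN.
Qed.

Lemma quad_sum_Nt M K (N : int) (H : int -> int -> int -> int -> int) :
  quad_sum M K N (fun x y z t => H x y z (- t)) = quad_sum M K N H.
Proof.
rewrite -[RHS](@sum_box_inv _ _ _ (fun p => (p.1, - p.2))) ?box4_uniq //.
- by apply: eq_bigr => -[[[x y] z] t] _ /=; rewrite mulrNN [in RHS]epsD epsN -epsD.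
- by case=> p t /=; rewrite opprK.
- by case=> [[[x y] z] t]; rewrite !mem_box4 => /and4P[-> -> -> /=]; rewrite ?normrN.
Qed.

Lemma quad_sum_xz M K (N : int) (H : int -> int -> int -> int -> int) :
  quad_sum M K N (fun x y z t => H z y x t) = quad_sum M K N H.
Proof.
rewrite -[RHS]quad_sum_xy -[RHS]quad_sum_yz -[RHS]quad_sum_xy.
exact: eq_quad_sum.
Qed.

(** On y = -x the quadratic form is t^2 - x^2. Thus z is free, and the sum over z is that of
    [sum_eps_sg]. *)
Lemma quad_sum_edge_line M K (N : int) : 
  quad_sum M K N (fun x y z t => (x + y == 0)%:R * edge_wt x y z t) = 0.
Proof.
rewrite /quad_sum sum_box4 big1_seq // => x /andP[_]; rewrite mem_zbox => xM.
rewrite big1 // => y _; rewrite exchange_big big1 //= => t _.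
case: (x + y =P 0) => [xy0|_]; last by rewrite big1 // => z _; rewrite mul0r mulr0.
pose c := (t * t - x * x == N)%:R * (eps t * (2 * sg x - sg (x + t) - sg (x - t))).
rewrite (eq_bigr (fun z => c * (eps z * sg (x + z)))).
  by rewrite -mulr_sumr sum_eps_sg ?mulr0.
move=> z _; rewrite /c /edge_wt xy0 sgr0 !add0r epsD mul1r.
have -> : x * y + y * z + z * x + t * t = t * t - x * x.
  by rewrite (_ : y = - x); [ring|lia].
by ring.
Qed.

(* edge_wt is antisymmetric under the automorphism (x, y, z, t) |-> (-x, z + 2x, y + 2x, t);
   the lines x + y = 0 and x + z = 0 are split off because its support is infinite there. *)
Lemma quad_sum_edge (M K : nat) (N : int) : 0 < N <= K%:Z -> (2 * K <= M)%N ->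
  quad_sum M K N edge_wt = 0.
Proof.
case/andP=> N0 NK KM.
(* The bound on t belongs to [gen] so that its support lies in the box; the automorphism fixes t. *)
pose gen x y z t := [&& x + y != 0, x + z != 0 & `|t| <= K%:Z]%:R * edge_wt x y z t.
have -> : quad_sum M K N edge_wt = quad_sum M K N gen +
    (quad_sum M K N (fun x y z t => (x + y == 0)%:R * edge_wt x y z t) +
     quad_sum M K N (fun x y z t => (x + y == 0)%:R * edge_wt x y z t)).
  rewrite -[X in _ + (_ + X)]quad_sum_yz -!quad_sumD.
  apply: eq_big_seq => -[[[x y] z] t]; rewrite mem_box4 => /and4P[_ _ _ tK].
  rewrite /gen tK andbT (_ : edge_wt x z y t = edge_wt x y z t); last first.
    by rewrite /edge_wt (addrC (sg (x + z))).
  congr (_ * _); case: (x + y =P 0) => [xy0|_]; case: (x + z =P 0) => [xz0|_] /=.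
  - by rewrite /edge_wt xy0 xz0 !sgr0 addr0 mul0r !mulr0 addr0.
  - by rewrite !mul0r mul1r add0r addr0.
  - by rewrite !mul0r mul1r !add0r.
  - by rewrite !mul0r mul1r !addr0.
rewrite quad_sum_edge_line !addr0.
apply: (@sum_antisym _ _ _ (fun p => (- p.1.1.1, p.1.2 + 2 * p.1.1.1, p.1.1.2 + 2 * p.1.1.1, p.2))).
- exact: box4_uniq.
- by case=> [[[x y] z] t] /=; congr (_, _, _, _); ring.
- case=> [[[x y] z] t]; rewrite /gen /edge_wt [fst _]/= [snd _]/=.
  have -> : - x * (z + 2 * x) + (z + 2 * x) * (y + 2 * x) + (y + 2 * x) * - x + t * t =
     x * y + y * z + z * x + t * t by ring.
  have -> : - x + (z + 2 * x) = x + z by ring.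
  have -> : - x + (y + 2 * x) = x + y by ring.
  have -> : eps (x + z + (y + 2 * x) + t) = eps (x + y + z + t).
    by apply: (@eps_eq _ _ x); ring.
  have -> : - x + t = - (x - t) by ring.
  have -> : - x - t = - (x + t) by ring.
  rewrite !sgrN [sg (x + z) + _]addrC andbCA.
  by ring.
case=> [[[x y] z] t]; rewrite mem_box4 /gen /edge_wt.
case: (_ =P N) => [Q|_]; last by rewrite !mul0r eqxx.
case: and3P => [[A0 C0 tK]|_]; last by rewrite mul0r mulr0 eqxx.
move=> F0.
have AC : sg (x + y) + sg (x + z) != 0 by apply: contraNneq F0 => ->; rewrite !(mul0r, mulr0).
have xt : 2 * sg x - sg (x + t) - sg (x - t) != 0.
  by apply: contraNneq F0 => ->; rewrite !(mul0r, mulr0).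
(* The quadratic form is (x + y)(x + z) + t^2 - x^2. A non-zero weight forces |x| <= |t| and a
   positive product (x + y)(x + z) <= N, so |y| and |z| are at most 2K. *)
have {}xt : `|x| <= `|t| by lia.
have {}AC : 0 < (x + y) * (x + z) by nia.
have x2 : x * x <= t * t by nia.
have ACN : (x + y) * (x + z) <= N by nia.
by clear -N0 NK KM A0 C0 tK xt AC ACN; nia.
Qed.

(** * Sums over the hyperbola ac = N *)

Definition hyp_term (N : int) (H : int -> int -> int) (a c : int) : int :=
  (a * c == N)%:R * eps (a + c) * ((sg a + sg c) * H a c).

Definition hyp_sum (K : nat) (N : int) (H : int -> int -> int) : int :=
  \sum_(a <- zbox K) \sum_(c <- zbox K) hyp_term N H a c.

Lemma hyp_sum_swap K (N : int) (H : int -> int -> int) :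
  hyp_sum K N (fun a c => H c a) = hyp_sum K N H.
Proof.
rewrite [RHS]exchange_big; apply: eq_bigr => a _; apply: eq_bigr => c _.
by rewrite /hyp_term (mulrC c) (addrC c) (addrC (sg c)).
Qed.

Lemma hyp_sumD K (N : int) (H H' : int -> int -> int) :
  hyp_sum K N (fun a c => H a c + H' a c) = hyp_sum K N H + hyp_sum K N H'.
Proof.
rewrite -big_split; apply: eq_bigr => a _; rewrite -big_split; apply: eq_bigr => c _.
by rewrite /hyp_term /=; ring.
Qed.

Lemma hyp_sum_divsum (K : nat) (N : int) : 0 < N <= K%:Z ->
  hyp_sum K N (fun a c => a + c) = 4 * divsum K N.
Proof.
case/andP=> N0 NK.
pose P (a c : int) := [&& 0 < a, 0 < c & a * c == N]%:R * eps (a + c) * (a + c).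
have -> : 4 * divsum K N = \sum_(a <- zbox K) \sum_(c <- zbox K) 2 * (P a c + P (- a) (- c)).
  transitivity (2 * (divsum K N + divsum K N)); first by ring.
  rewrite /divsum sum_box2 -/P -[X in _ + X]sum_zboxN.
  under [X in _ + X]eq_bigr => a _ do rewrite -sum_zboxN.
  rewrite -big_split mulr_sumr; apply: eq_bigr => a _.
  by rewrite -big_split mulr_sumr.
apply: eq_bigr => a _; apply: eq_bigr => c _; rewrite /hyp_term /P mulrNN.
rewrite -opprD epsN; case: (a * c =P N) => [ac|_]; last by rewrite !andbF !mul0r mulr0.
rewrite !andbT !oppr_gt0 mul1r.
case: (ltrgtP 0 a) => [a0|a0|a0]; last by move: ac; rewrite -a0 mul0r; lia.
  have c0 : 0 < c by nia.
  have -> : (c < 0) = false by lia.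
  by rewrite c0 /= (gtr0_sg a0) (gtr0_sg c0) !mul1r !mul0r; ring.
have c0 : c < 0 by nia.
have -> : (0 < c) = false by lia.
by rewrite c0 /= (ltr0_sg a0) (ltr0_sg c0) !mul1r !mul0r; ring.
Qed.

Lemma factor_le (a c N : int) : 0 < N -> a * c = N -> `|a| <= N.
Proof.
move=> N0 ac; case: (ltrgtP c 0) => c0; last by move: ac; rewrite c0 mulr0; lia.
  have a0 : a < 0 by nia.
  by rewrite ltr0_norm //; nia.
have a0 : 0 < a by nia.
by rewrite gtr0_norm //; nia.
Qed.

Lemma norm_add_le (a c : int) : 0 < a * c -> `|a + c| <= a * c + 1.
Proof.
move=> ac; case: (ltrP 0 a) => a0.
  have c0 : 0 < c by nia.
  by rewrite gtr0_norm ?addr_gt0 //; nia.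
have c0 : c < 0 by nia.
have {}a0 : a < 0 by nia.
have : 0 <= (-1 - a) * (-1 - c) by apply: mulr_ge0; lia.
by lia.
Qed.

Lemma hyp_sum_shift (M K : nat) (N t : int) (H : int -> int -> int) :
  0 < N <= K%:Z -> (2 * K <= M)%N -> `|t| <= K%:Z ->
  \sum_(y <- zbox M) \sum_(z <- zbox M) hyp_term N H (y - t) (z - t) = hyp_sum K N H.
Proof.
case/andP=> N0 NK KM tK.
have supp (a c : int) : hyp_term N H a c != 0 -> (`|a| <= K%:Z) && (`|c| <= K%:Z).
  rewrite /hyp_term; case: (_ =P N) => [ac _|_]; last by rewrite !mul0r eqxx.
  by have := factor_le N0 ac; rewrite mulrC in ac; have := factor_le N0 ac; lia.
rewrite -(sum_box2 _ _ (fun p => hyp_term N H (p.1 - t) (p.2 - t))).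
rewrite /hyp_sum -(sum_box2 _ _ (fun p => hyp_term N H p.1 p.2)).
pose F p := hyp_term N H p.1 p.2.
rewrite (sum_supp (box2_uniq K K) (box2_uniq M M) (F := F)); last first.
  by case=> a c /supp/andP[/= ? ?]; rewrite !mem_box2; lia.
rewrite -(sum_reindex (f := fun p => (p.1 - t, p.2 - t))
  (g := fun p => (p.1 + t, p.2 + t)) (F := F)) //; first exact: box2_uniq.
- by case=> a c /=; rewrite !subrK.
- by case=> a c /=; rewrite !addrK.
by case=> a c /supp/andP[/= ? ?]; rewrite !mem_box2 /=; lia.
Qed.

Lemma quad_sum_nested M K (N : int) (H : int -> int -> int -> int -> int) :
  quad_sum M K N H =
  \sum_(t <- zbox K) \sum_(x <- zbox M) \sum_(y <- zbox M) \sum_(z <- zbox M)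
    (x * y + y * z + z * x + t * t == N)%:R * eps (x + y + z + t) * H x y z t.
Proof.
rewrite /quad_sum sum_box4 [RHS]exchange_big; apply: eq_bigr => x _ /=.
rewrite [RHS]exchange_big; apply: eq_bigr => y _ /=.
by rewrite [RHS]exchange_big.
Qed.

Lemma hyp_sum_linear (K : nat) (N : int) (c : int -> int -> int) :
  0 < N <= K%:Z -> (forall a b, a * b = N -> `|c a b| <= 2 * K%:Z) ->
  \sum_(t <- zbox K) hyp_sum K N (fun a b => sg (c a b + 2 * t)) = hyp_sum K N c.
Proof.
move=> NK cK; rewrite exchange_big; apply: eq_bigr => a _ /=.
rewrite exchange_big; apply: eq_bigr => b _ /=.
rewrite /hyp_term -mulr_sumr; case: (a * b =P N) => [/cK ab|_]; last by rewrite !mul0r.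
by rewrite -mulr_sumr sum_sg_double.
Qed.

(** With x = -t, a = y - t and c = z - t, the quadratic form is ac and the weight is (sg a + sg c)
    sg (c + 2t); summing over t replaces the last sign by c. *)
Lemma quad_sum_face_x (M K : nat) (N : int) : 0 < N <= K%:Z -> (2 * K <= M)%N ->
  quad_sum M K N (fun x y z t => (x == - t)%:R * face_wt x y z t) =
  hyp_sum K N (fun a c => c).
Proof.
move=> N0K KM; have /andP[N0 NK] := N0K.
rewrite quad_sum_nested -hyp_sum_linear //; last first.
  by move=> a b ab; rewrite mulrC in ab; have := factor_le N0 ab; lia.
apply: eq_big_seq => t; rewrite mem_zbox => tK.
rewrite -(hyp_sum_shift _ N0K KM tK).
transitivity (\sum_(x <- zbox M) (x == - t)%:R *
  \sum_(y <- zbox M) \sum_(z <- zbox M)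
    hyp_term N (fun _ b => sg (b + 2 * t)) (y - t) (z - t)).
  apply: eq_bigr => x _; rewrite mulr_sumr; apply: eq_bigr => y _.
  rewrite mulr_sumr; apply: eq_bigr => z _.
  case: (x =P - t) => [->|_]; last by rewrite !mul0r mulr0.
  rewrite !mul1r /hyp_term /face_wt addNr sgr0 add0r.
  have -> : - t * y + y * z + z * - t + t * t = (y - t) * (z - t) by ring.
  have -> : eps (- t + y + z + t) = eps (y - t + (z - t)) by apply: (@eps_eq _ _ t); ring.
  have -> : z - t + 2 * t = z + t by ring.
  by rewrite (addrC (- t) z); ring.
by rewrite (@sum_zbox1 _ (fun=> _)) //; lia.
Qed.

(** Here a = x + t, c = z + t and x + z = a + c - 2t; the sign of t is reversed to match
    [hyp_sum_linear]. *)
Lemma quad_sum_face_y (M K : nat) (N : int) : 0 < N <= K%:Z -> (2 * K <= M)%N ->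
  quad_sum M K N (fun x y z t => (y == t)%:R * face_wt x y z t) =
  hyp_sum K N (fun a c => a + c).
Proof.
move=> N0K KM; have /andP[N0 NK] := N0K.
rewrite quad_sum_nested -hyp_sum_linear //; last first.
  move=> a b ab; have := factor_le N0 ab; rewrite mulrC in ab.
  by have := factor_le N0 ab; lia.
rewrite -[RHS]sum_zboxN; apply: eq_big_seq => t; rewrite mem_zbox => tK.
have NtK : `|- t| <= K%:Z by rewrite normrN.
rewrite -(hyp_sum_shift _ N0K KM NtK); apply: eq_bigr => x _.
transitivity (\sum_(y <- zbox M) (y == t)%:R *
  \sum_(z <- zbox M) hyp_term N (fun a b => sg (a + b + 2 * - t)) (x - - t) (z - - t)).
  apply: eq_bigr => y _; rewrite mulr_sumr; apply: eq_bigr => z _.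
  case: (y =P t) => [->|_]; last by rewrite !mul0r mulr0.
  rewrite !mul1r /hyp_term /face_wt subrr sgr0 add0r !opprK.
  have -> : x * t + t * z + z * x + t * t = (x + t) * (z + t) by ring.
  have -> : eps (x + t + z + t) = eps (x + t + (z + t)) by congr eps; ring.
  have -> : x + t + (z + t) + 2 * - t = x + z by ring.
  by ring.
by rewrite (@sum_zbox1 _ (fun=> _)) //; lia.
Qed.

Lemma quad_sum_face_line (M K : nat) (N : int) : (K <= M)%N ->
  quad_sum M K N (fun x y z t => (x + z == 0)%:R * face_wt x y z t) = 0.
Proof.
move=> KM; rewrite quad_sum_nested big1_seq // => t /andP[_]; rewrite mem_zbox => tK.
rewrite big1 // => x _; rewrite exchange_big big1 //= => z _.
case: (x + z =P 0) => [xz0|_]; last by rewrite big1 // => y _; rewrite mul0r mulr0.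
pose c := (t * t - x * x == N)%:R * (eps t * (sg (x + t) + sg (z + t))).
rewrite (eq_bigr (fun y => c * (eps y * sg (- t + y)))).
  by rewrite -mulr_sumr sum_eps_sg ?mulr0 //; lia.
move=> y _; rewrite /c /face_wt xz0 sgr0 addr0 mul1r.
have Dz : z = - x by lia.
have -> : x * y + y * z + z * x + t * t = t * t - x * x by rewrite Dz; ring.
have -> : x + y + z + t = y + t by rewrite Dz; ring.
by rewrite epsD (addrC (- t)); ring.
Qed.

(* The automorphism fixing x + t, z + t and negating y - t, x + z preserves
   N = (x + t)(z + t) + (y - t)(x + z) and changes the sign of face_wt.  Only the points where
   one of these four forms vanishes can contribute: there the support is infinite and the box
   |t| <= K is not invariant. *)
Lemma quad_sum_face (M K : nat) (N : int) : 0 < N <= K%:Z -> (2 * K <= M)%N ->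
  quad_sum M K N face_wt = 8 * divsum K N.
Proof.
move=> N0K KM; have /andP[N0 NK] := N0K.
pose gen (x y z t : int) := [&& x != - t, z != - t, y != t & x + z != 0]%:R * face_wt x y z t.
have -> : quad_sum M K N face_wt = quad_sum M K N gen +
    quad_sum M K N (fun x y z t => (x == - t)%:R * face_wt x y z t) +
    quad_sum M K N (fun x y z t => (x == - t)%:R * face_wt x y z t) +
    quad_sum M K N (fun x y z t => (y == t)%:R * face_wt x y z t) +
    quad_sum M K N (fun x y z t => (x + z == 0)%:R * face_wt x y z t).
  rewrite -[X in _ + X + _ + _]quad_sum_xz -!quad_sumD.
  apply: eq_quad_sum => x y z t Q; rewrite /gen.
  have -> : face_wt z y x t = face_wt x y z t.
    by rewrite /face_wt (addrC (sg (z + t))) (addrC z x).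
  rewrite -!mulrDl; case: (face_wt x y z t =P 0) => [->|F0]; first by rewrite mulr0.
  (* No two of the four forms vanish together: the weight, or else the quadratic form, would be 0.
     So exactly one of the five indicators is 1. *)
  have xz : ~~ ((x == - t) && (z == - t)).
    by apply/negP => /andP[/eqP xt /eqP zt]; apply: F0; rewrite /face_wt xt zt addNr sgr0 mul0r.
  have yv : ~~ ((y == t) && (x + z == 0)).
    by apply/negP => /andP[/eqP yt /eqP v0]; apply: F0; rewrite /face_wt yt v0 subrr sgr0 mulr0.
  have xy : ~~ ((x == - t) && (y == t)).
    by apply/negP => /andP[/eqP xt /eqP yt]; move: Q; rewrite xt yt; nia.
  have zy : ~~ ((z == - t) && (y == t)).
    by apply/negP => /andP[/eqP zt /eqP yt]; move: Q; rewrite zt yt; nia.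
  have xv : ~~ ((x == - t) && (x + z == 0)).
    apply/negP => /andP[/eqP xt /eqP v0]; have zt : z = t by lia.
    by move: Q; rewrite xt zt; nia.
  have zv : ~~ ((z == - t) && (x + z == 0)).
    apply/negP => /andP[/eqP zt /eqP v0]; have xt : x = t by lia.
    by move: Q; rewrite xt zt; nia.
  rewrite -[LHS]mul1r; congr (_ * _); clear Q F0 N0K N0 NK KM.
  by move: xz yv xy zy xv zv; do 4 case: (_ == _).
rewrite quad_sum_face_x // quad_sum_face_y // quad_sum_face_line; last by lia.
have hyp_double : hyp_sum K N (fun a c => c) + hyp_sum K N (fun a c => c) =
    hyp_sum K N (fun a c => a + c).
  by rewrite -{1}hyp_sum_swap -hyp_sumD.
rewrite addr0 -[_ + _ + hyp_sum K N (fun _ c => c)]addrA hyp_double hyp_sum_divsum //.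
suff -> : quad_sum M K N gen = 0 by ring.
apply: (@sum_antisym _ _ _ (fun p =>
  (- p.1.2, 2 * p.2 + p.1.1.1 + p.1.2 - p.1.1.2, - p.1.1.1, p.2 + p.1.1.1 + p.1.2))).
- exact: box4_uniq.
- by case=> [[[x y] z] t] /=; congr (_, _, _, _); ring.
- case=> [[[x y] z] t]; rewrite /gen /face_wt [fst _]/= [snd _]/=.
  set y' := 2 * t + x + z - y; set t' := t + x + z.
  have -> : - z * y' + y' * - x + - x * - z + t' * t' = x * y + y * z + z * x + t * t.
    by rewrite /y' /t'; ring.
  have -> : eps (- z + y' + - x + t') = eps (x + y + z + t).
    by apply: (@eps_eq _ _ (t - y)); rewrite /y' /t'; ring.
  have -> : - z + t' = x + t by rewrite /t'; ring.
  have -> : - x + t' = z + t by rewrite /t'; ring.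
  have -> : y' - t' = - (y - t) by rewrite /y' /t'; ring.
  have -> : - z + - x = - (x + z) by ring.
  have -> : [&& - z != - t', - x != - t', y' != t' & - (x + z) != 0] =
      [&& x != - t, z != - t, y != t & x + z != 0] by rewrite /y' /t'; lia.
  by rewrite !sgrN; ring.
case=> [[[x y] z] t]; rewrite mem_box4 /gen /face_wt.
case: (_ =P N) => [Q|_]; last by rewrite !mul0r eqxx.
case: and4P => [[P0 Q0 U0 V0]|_]; last by rewrite mul0r mulr0 eqxx.
move=> F0.
have PQ : sg (x + t) + sg (z + t) != 0 by apply: contraNneq F0 => ->; rewrite !(mul0r, mulr0).
have UV : sg (y - t) + sg (x + z) != 0 by apply: contraNneq F0 => ->; rewrite !(mul0r, mulr0).
have {}PQ : 0 < (x + t) * (z + t) by clear -PQ P0 Q0; nia.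
have {}UV : 0 < (y - t) * (x + z) by clear -UV U0 V0; nia.
have E : (x + t) * (z + t) + (y - t) * (x + z) = N by rewrite -Q; ring.
have : `|x + t| <= N - (y - t) * (x + z) by apply: (factor_le (c := z + t)); lia.
have : `|z + t| <= N - (y - t) * (x + z) by apply: (factor_le (c := x + t)); lia.
have : `|y - t| <= N - (x + t) * (z + t) by apply: (factor_le (c := x + z)); lia.
have : `|x + z| <= N - (x + t) * (z + t) by apply: (factor_le (c := y - t)); lia.
(* Since 2t = (x + t) + (z + t) - (x + z), this and the bound on x + z give |2t| <= N + 1. *)
have : `|x + t + (z + t)| <= (x + t) * (z + t) + 1 by apply: norm_add_le.
by clear -N0 NK KM E PQ UV; lia.
Qed.

(* Twice the value predicted for the n-th coefficient of theta^3, up to sign. *)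
Definition class_coef (M : nat) (n : int) : int :=
  - \sum_(x <- zbox M) \sum_(y <- zbox M) \sum_(z <- zbox M)
      (x * y + y * z + z * x == n)%:R * eps (x + y + z) * dom x y z.

(** The left side is minus the sum of [dom] over the quadric. In [dom_decomp] the three edge sums
    vanish and the two face sums, exchanged by t |-> -t, give 8 [divsum] each. *)
Lemma kronecker_class_relation (M K : nat) (N : int) : 0 < N <= K%:Z -> (2 * K <= M)%N ->
  theta K (class_coef M) N = 2 * jacobi_coef K N.
Proof.
move=> N0K KM; have /andP[N0 NK] := N0K.
have -> : theta K (class_coef M) N = - quad_sum M K N (fun x y z _ => dom x y z).
  rewrite quad_sum_nested -sumrN; apply: eq_bigr => t _.
  rewrite /class_coef mulrN mulr_sumr; congr (- _); apply: eq_bigr => x _.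
  rewrite mulr_sumr; apply: eq_bigr => y _; rewrite mulr_sumr; apply: eq_bigr => z _.
  have -> : (x * y + y * z + z * x == N - t * t) = (x * y + y * z + z * x + t * t == N) by lia.
  by rewrite [in RHS]epsD; ring.
have : 2 * quad_sum M K N (fun x y z _ => dom x y z) = 16 * divsum K N.
  rewrite -quad_sumZ (@eq_quad_sum _ _ _ _ (fun x y z t =>
    edge_wt x y z t + edge_wt y x z t + edge_wt z y x t +
    face_wt x y z t + face_wt x y z (- t))); last first.
    by move=> x y z t Q; apply: dom_decomp; rewrite Q.
  rewrite !quad_sumD quad_sum_Nt (quad_sum_xy _ _ _ edge_wt) (quad_sum_xz _ _ _ edge_wt).
  by rewrite (quad_sum_edge N0K KM) (quad_sum_face N0K KM); ring.
have /negbTE N_neq0 : N != 0 by lia.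
rewrite /jacobi_coef N_neq0 mulrBr mulr0 sub0r mulrA => E; apply/eqP; rewrite eqr_opp; apply/eqP.
by lia.
Qed.

(** Consequently, for n > 0 no solution has negative weight, and only [eps] can cause
    cancellation. *)
Lemma dom_eq0_or_pos (x y z : int) :
  dom x y z = 0 \/ (0 < dom x y z /\ 0 < x * y + y * z + z * x) \/
  (dom x y z = -2 /\ [/\ x = 0, y = 0 & z = 0]).
Proof.
rewrite /dom; case: (sgrP x) => x0; case: (sgrP y) => y0; case: (sgrP z) => z0;
  rewrite ?x0 ?y0 ?z0 ?eqxx ?(lt_eqF x0) ?(lt_eqF y0) ?(lt_eqF z0) 
          ?(gt_eqF x0) ?(gt_eqF y0) ?(gt_eqF z0) /=;
  first [by left | by right; left; split => //; nia | by right; right].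
Qed.

(** * Sums of three squares *)

Lemma sum_neq0 (T : Type) (s : seq T) (F : T -> int) :
  \sum_(v <- s) F v != 0 -> exists v, F v != 0.
Proof.
elim: s => [|v s IHs]; first by rewrite big_nil eqxx.
rewrite big_cons; case: (F v =P 0) => [->|/eqP Fv _]; last by exists v.
by rewrite add0r.
Qed.

(** For positive indices, theta times either side is twice theta^4, by [theta_pow4] and the class
    number relation. Convolution with theta is injective. *)
Lemma theta_pow3 (M K : nat) (n : int) : (2 * K <= M)%N -> n <= K%:Z ->
  2 * theta_pow K 3 n = class_coef M n.
Proof.
move=> KM nK; apply/eqP; rewrite -subr_eq0; apply/eqP.
pose a n := 2 * theta_pow K 3 n - class_coef M n; rewrite -/(a n).
apply: (square_conv_eq0 (K := K) (w := fun _ t => eps t)) nK.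
  move=> m m0; rewrite /a theta_pow_neg // /class_coef big1 ?oppr0 ?subr0 // => x _.
  rewrite big1 // => y _; rewrite big1 // => z _.
  case: eqP => [Q|_]; last by rewrite !mul0r.
  by case: (dom_eq0_or_pos x y z) => [->|[[_ H]|[_ [x0 y0 z0]]]]; rewrite ?mulr0 //; nia.
move=> m /andP[m_ge0 mK]; case: (eqVneq m 0) => [->|m0]; [left|right].
  (* At n = 0 only the origin has non-zero weight, namely -2. *)
  rewrite /a theta_pow_at0 /class_coef.
  rewrite (eq_bigr (fun x => (x == 0)%:R * \sum_(y <- zbox M) (y == 0)%:R *
     \sum_(z <- zbox M) (z == 0)%:R * (-2))); last first.
    move=> x _; rewrite mulr_sumr; apply: eq_bigr => y _.
    rewrite mulrA mulr_sumr; apply: eq_bigr => z _.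
    rewrite mulrA -!natrM !mulnb.
    case: (dom_eq0_or_pos x y z) => [d0|[[_ H]|[_ [-> -> ->]]]]; last by [].
      rewrite d0 mulr0; case: (x =P 0) => [x0|_]; last by rewrite mul0r.
      case: (y =P 0) => [y0|_]; last by rewrite mul0r.
      case: (z =P 0) => [z0|_]; last by rewrite mul0r.
      by move: d0; rewrite x0 y0 z0.
    have /negbTE -> : x * y + y * z + z * x != 0 by lia.
    rewrite !mul0r; case: (x =P 0) => [x0|_]; last by rewrite mul0r.
    case: (y =P 0) => [y0|_]; last by rewrite mul0r.
    by move: H; rewrite x0 y0 !mul0r mulr0 addr0.
  by rewrite !(@sum_zbox1 _ (fun=> _)).
split; first exact: eps_neq0.
have m_pos : 0 < m <= K%:Z by lia.
have E4 := theta_pow4 mK; rewrite [theta_pow]lock /= -lock in E4.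
have := kronecker_class_relation m_pos KM; rewrite -E4 /theta => E.
under eq_bigr => t _ do rewrite /a mulrBr.
rewrite sumrB E -/(theta_pow _ 3) mulr_sumr; apply/eqP; rewrite subr_eq0; apply/eqP.
by apply: eq_bigr => t _; rewrite mulrCA.
Qed.

Lemma three_squares_of_class_coef (n : int) : 0 <= n ->
  class_coef (2 * absz n) n != 0 -> exists u v w : int, n = u * u + v * v + w * w.
Proof.
move=> n0; rewrite -(@theta_pow3 _ (absz n)); [|lia|lia].
rewrite mulf_eq0 /= => /sum_neq0[u]; rewrite mulf_eq0 (negbTE (eps_neq0 u)) /=.
case/sum_neq0=> v; rewrite mulf_eq0 (negbTE (eps_neq0 v)) /=.
case/sum_neq0=> w; rewrite mulf_eq0 (negbTE (eps_neq0 w)) /=.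
by case: eqP => // E _; exists u, v, w; lia.
Qed.

(** * Non-vanishing of the coefficients of theta^3 *)

Definition class_term (n : int) (e : int -> int -> int -> int) (p : int * int * int) : int :=
  let: (x, y, z) := p in (x * y + y * z + z * x == n)%:R * e x y z * dom x y z.

Lemma class_coefE M n :
  class_coef M n = - \sum_(p <- box3 M M) class_term n (fun x y z => eps (x + y + z)) p.
Proof. by rewrite sum_box3. Qed.

Lemma class_term_ge0 (n : int) e p : 0 < n -> (forall x y z, 0 <= e x y z) ->
  0 <= class_term n e p.
Proof.
case: p => [[x y] z] n0 e0 /=; case: eqP => [Q|_]; last by rewrite !mul0r.
rewrite mul1r mulr_ge0 //.
by case: (dom_eq0_or_pos x y z) => [->|[[/ltW]|[_ [x0 y0 z0]]]] //; move: Q; rewrite x0 y0 z0; lia.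
Qed.

Lemma class_sum_gt0 (n : int) (M : nat) e (p : int * int * int) :
  0 < n -> (forall x y z, 0 <= e x y z) -> p \in box3 M M -> 0 < class_term n e p ->
  0 < \sum_(p <- box3 M M) class_term n e p.
Proof.
move=> n0 e0 pM p0; rewrite (bigD1_seq p) ?box3_uniq //=.
apply: ltr_wpDr => //; apply: sumr_ge0 => q _.
exact: class_term_ge0.
Qed.

Lemma eps_mod2 (x : int) : eps x = if (x %% 2)%Z == 0 then 1 else -1.
Proof.
case: eqP => E; first by rewrite (@eps_eq x 0 (x %/ 2)%Z) //; lia.
by rewrite (@eps_eq x 1 (x %/ 2)%Z) //; lia.
Qed.

Lemma halves (x : int) : exists a, x = 2 * a \/ x = 2 * a + 1.
Proof. by exists (x %/ 2)%Z; lia. Qed.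

(** Here n mod 4 fixes the parity of x + y + z, so all terms have one sign and (1, n, 0)
    contributes. *)
Lemma class_coef_neq0_12 (n : int) : 0 < n -> (n %% 4)%Z \in [:: 1; 2] ->
  class_coef (2 * absz n) n != 0.
Proof.
move=> n0 n4; set M := (2 * absz n)%N.
have sgn x y z : x * y + y * z + z * x = n ->
    eps (x + y + z) = if (n %% 4)%Z == 1 then 1 else -1.
  rewrite eps_mod2 => Q; congr (if _ then _ else _); move: n4; rewrite -Q !inE.
  have [a Dx] := halves x; have [b Dy] := halves y; have [c Dz] := halves z.
  by case: Dx => ->; case: Dy => ->; case: Dz => ->; lia.
rewrite class_coefE oppr_eq0; set c := if _ then _ else _ in sgn.
rewrite (eq_bigr (fun p => c * class_term n (fun _ _ _ => 1) p)); last first.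
  move=> [[x y] z] _ /=; case: (_ =P n) => [/sgn ->|_]; last by rewrite !mul0r mulr0.
  by rewrite mulr1 !mul1r.
rewrite -mulr_sumr mulf_neq0 //; first by rewrite /c; case: ifP.
rewrite gt_eqF //; apply: (@class_sum_gt0 _ _ _ (1, n, 0)) => //.
  by rewrite mem_box3 /M; lia.
by rewrite /= /dom !mulr0 mul0r !addr0 !mul1r eqxx mul1r; lia.
Qed.

Lemma sum_inj_le (T : eqType) (s : seq T) (A B : T -> int) (f g : T -> T) :
  uniq s -> (forall q, 0 <= B q) ->
  (forall p, p \in s -> A p != 0 -> [/\ f p \in s, g (f p) = p & A p <= B (f p)]) ->
  \sum_(p <- s) A p <= \sum_(q <- s) B q.
Proof.
move=> s_uniq B0 fP; pose s' := [seq p <- s | A p != 0].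
have fP' p : p \in s' -> [/\ f p \in s, g (f p) = p & A p <= B (f p)].
  by rewrite mem_filter => /andP[Ap ps]; apply: fP.
have -> : \sum_(p <- s) A p = \sum_(p <- s') A p.
  rewrite big_filter [LHS](bigID (fun p => A p != 0)) /= [X in _ + X]big1 ?addr0 //.
  by move=> p; rewrite negbK => /eqP.
have fs'_uniq : uniq (map f s').
  rewrite map_inj_in_uniq ?filter_uniq // => p q /fP'[_ gp _] /fP'[_ gq _] E.
  by rewrite -gp -gq E.
apply: (@le_trans _ _ (\sum_(q <- map f s') B q)).
  rewrite big_map [leLHS]big_seq [leRHS]big_seq.
  by apply: ler_sum => p /fP'[].
rewrite [X in _ <= X](bigID (fun q => q \in map f s')) /= -[X in _ <= X + _]big_filter.
rewrite (perm_big [seq q <- s | q \in map f s']) /=.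
  by rewrite lerDl sumr_ge0.
apply: uniq_perm; rewrite ?filter_uniq // => q; rewrite mem_filter.
by case: (boolP (q \in map f s')) => //= /mapP[p /fP'[fps _ _] ->].
Qed.

Definition odd_triple (x y z : int) : int :=
  ((x %% 2 == 1) && (y %% 2 == 1) && (z %% 2 == 1))%Z%:R.
Definition mid_even_triple (x y z : int) : int :=
  ((x %% 2 == 1) && (y %% 2 == 0) && (z %% 2 == 1))%Z%:R.

(* A form with obtuse superbase conorms (x, y, z), all odd, is mapped to its sublattice of
   index 2 spanned by one vector and twice another, rescaled. *)
Definition to_mid_even (p : int * int * int) : int * int * int :=
  let: (x, y, z) := p in
  if `|x| <= `|y| then (x, ((y - x) %/ 2)%Z, x + 2 * z)
  else (y + 2 * z, ((x - y) %/ 2)%Z, y).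
Definition of_mid_even (p : int * int * int) : int * int * int :=
  let: (x, e, z) := p in
  if `|x| < `|z| then (x, x + 2 * e, ((z - x) %/ 2)%Z)
  else (z + 2 * e, z, ((x - z) %/ 2)%Z).

Lemma dom_bound (x y z : int) : 0 < dom x y z ->
  [/\ `|x| <= x * y + y * z + z * x, `|y| <= x * y + y * z + z * x &
      `|z| <= x * y + y * z + z * x].
Proof.
rewrite /dom; case: (sgrP x) => x0; case: (sgrP y) => y0; case: (sgrP z) => z0.
all: rewrite ?x0 ?y0 ?z0 ?eqxx ?(lt_eqF x0) ?(lt_eqF y0) ?(lt_eqF z0)
  ?(gt_eqF x0) ?(gt_eqF y0) ?(gt_eqF z0) //=.
all: move=> _; split; nia.
Qed.

(** The factor 2 is for x = y: the image then has a zero coordinate, with weight 2 instead of 4. The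
    comparison of absolute values keeps the signs of the image equal and lets [of_mid_even] recover
    the branch. *)
Lemma to_mid_evenP (n x y z : int) : (n %% 8)%Z = 3 -> 0 < n ->
  class_term n odd_triple (x, y, z) != 0 ->
  of_mid_even (to_mid_even (x, y, z)) = (x, y, z) /\
  class_term n odd_triple (x, y, z) <=
    2 * class_term n mid_even_triple (to_mid_even (x, y, z)).
Proof.
move=> n8 n0; rewrite [class_term _ _ _]/= {1 2}/odd_triple.
case: (_ =P n) => [Q|_]; last by rewrite !mul0r eqxx.
case: andP => [[/andP[/eqP x2 /eqP y2] /eqP z2]|_]; last by rewrite mulr0 mul0r eqxx.
rewrite !mul1r => d0.
have d4 : dom x y z = 4 /\ ((0 < x /\ 0 < y /\ 0 < z) \/ (x < 0 /\ y < 0 /\ z < 0)).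
  case: (dom_eq0_or_pos x y z) => [d|[[d _]|[_ [x0 _ _]]]]; [by rewrite d in d0| |lia].
  by move: d; rewrite /dom; lia.
case: d4 => -> same.
(* Otherwise n would be 7 mod 8. This makes the new middle coordinate even. *)
have xy4 : ((y - x) %% 4)%Z = 0.
  have [a Dx] := halves ((x - 1) %/ 2)%Z; have [b Dy] := halves ((y - 1) %/ 2)%Z.
  have [c Dz] := halves ((z - 1) %/ 2)%Z.
  have {}Dx : x = 4 * a + 1 \/ x = 4 * a + 3 by lia.
  have {}Dy : y = 4 * b + 1 \/ y = 4 * b + 3 by lia.
  have {}Dz : z = 4 * c + 1 \/ z = 4 * c + 3 by lia.
  rewrite -Q in n8; clear -n8 Dx Dy Dz; move: n8.
  by case: Dx => ->; case: Dy => ->; case: Dz => ->; lia.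
have [e De] : exists e, y = x + 4 * e by exists ((y - x) %/ 4)%Z; lia.
rewrite /to_mid_even; case: ifP => xy.
  have -> : ((y - x) %/ 2)%Z = 2 * e by lia.
  rewrite /of_mid_even; have -> : `|x| < `|x + 2 * z| by lia.
  split; first by congr (_, _, _); lia.
  rewrite /= /mid_even_triple.
  have -> : x * (2 * e) + 2 * e * (x + 2 * z) + (x + 2 * z) * x = n.
    by rewrite -Q De; ring.
  have -> : ((x %% 2 == 1) && ((2 * e) %% 2 == 0) && ((x + 2 * z) %% 2 == 1))%Z by lia.
  by rewrite eqxx !mul1r /dom; lia.
have -> : ((x - y) %/ 2)%Z = - (2 * e) by lia.
rewrite /of_mid_even; have -> : `|y + 2 * z| < `|y| = false by lia.
split; first by congr (_, _, _); lia.
rewrite /= /mid_even_triple.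
have -> : (y + 2 * z) * - (2 * e) + - (2 * e) * y + y * (y + 2 * z) = n.
  by rewrite -Q De; ring.
have -> : (((y + 2 * z) %% 2 == 1) && ((- (2 * e)) %% 2 == 0) && (y %% 2 == 1))%Z by lia.
by rewrite eqxx !mul1r /dom; lia.
Qed.

Lemma class_term_supp n e p :
  0 < n -> class_term n e p != 0 -> p \in box3 (2 * absz n) (2 * absz n).
Proof.
case: p => [[x y] z] n0 /=; case: (_ =P n) => [Q|_]; last by rewrite !mul0r eqxx.
case: (dom_eq0_or_pos x y z) => [->|[[d _]|[_ [x0 y0 z0]]]]; first by rewrite mulr0 eqxx.
  by have [] := dom_bound d; rewrite mem_box3; lia.
by move: Q; rewrite x0 y0 z0; lia.
Qed.

(** As n is odd, a solution is all odd or has exactly one even coordinate. By symmetry the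
    coefficient is O - 3B, with O the all-odd sum and B the sum with even middle. Now O <= 2B by
    [to_mid_even], and B > 0 because of (1, 0, n). *)
Lemma class_coef_neq0_3 (n : int) : 0 < n -> (n %% 8)%Z = 3 ->
  class_coef (2 * absz n) n != 0.
Proof.
move=> n0 n8; set M := (2 * absz n)%N.
pose B := \sum_(p <- box3 M M) class_term n mid_even_triple p.
have ind_ge0 (b : bool) : 0 <= b%:R :> int by case: b.
have B_ge : \sum_(p <- box3 M M) class_term n odd_triple p <= 2 * B.
  rewrite mulr_sumr; apply: (@sum_inj_le _ _ _ _ to_mid_even of_mid_even).
  - exact: box3_uniq.
  - by move=> q; rewrite mulr_ge0 // class_term_ge0 // => *; apply: ind_ge0.
  move=> [[x y] z] _ t0; have [-> le_t] := to_mid_evenP n8 n0 t0.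
  split=> //; apply: (class_term_supp (e := mid_even_triple) n0).
  have : 0 <= class_term n odd_triple (x, y, z).
    by apply: class_term_ge0 => // *; apply: ind_ge0.
  rewrite le_eqVlt eq_sym (negbTE t0) => /lt_le_trans/(_ le_t).
  by apply: contraTneq => ->; rewrite mulr0 ltxx.
have B_gt0 : 0 < B.
  apply: (@class_sum_gt0 _ _ _ (1, 0, n)) => //.
    by rewrite mem_box3 /M; lia.
  have d2 : dom 1 0 n = 2 by rewrite /dom (gtr0_sg n0); have /negbTE -> : n != 0 by lia.
  have n2 : (n %% 2)%Z = 1 by lia.
  by rewrite /= /mid_even_triple d2 n2 (_ : 1 * 0 + 0 * n + n * 1 == n) //; lia.
pose b1 x y z := mid_even_triple y x z; pose b3 x y z := mid_even_triple x z y.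
have B1 : \sum_(p <- box3 M M) class_term n b1 p = B.
  rewrite /B !sum_box3 exchange_big; apply: eq_bigr => x _; apply: eq_bigr => y _.
  apply: eq_bigr => z _; rewrite /= /b1 /dom.
  have -> : y * x + x * z + z * y = x * y + y * z + z * x by ring.
  by congr (_ * _); rewrite (andbC (y == 0)) (andbC (x == 0) (z == 0)) (andbC (z == 0) (y == 0)); ring.
have B3 : \sum_(p <- box3 M M) class_term n b3 p = B.
  rewrite /B !sum_box3; apply: eq_bigr => x _; rewrite exchange_big.
  apply: eq_bigr => y _; apply: eq_bigr => z _; rewrite /= /b3 /dom.
  have -> : x * z + z * y + y * x = x * y + y * z + z * x by ring.
  by congr (_ * _); rewrite (andbC (x == 0)) (andbC (z == 0) (y == 0)) (andbC (y == 0) (x == 0)); ring.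
suff : class_coef M n = \sum_(p <- box3 M M) class_term n odd_triple p - (B + B + B).
  by move=> ->; lia.
rewrite -{1}B1 -{2}B3 /B class_coefE -!big_split -[LHS]sumrN -[X in _ = _ + X]sumrN -big_split /=.
apply: eq_bigr => -[[x y] z] _ /=; case: (_ =P n) => [Q|_]; last first.
  by rewrite !mul0r !oppr0 !addr0.
rewrite !mul1r; suff E : - eps (x + y + z) =
    odd_triple x y z - (b1 x y z + mid_even_triple x y z + b3 x y z).
  by rewrite -mulNr E; ring.
rewrite eps_mod2 /odd_triple /mid_even_triple /b1 /b3 /mid_even_triple.
have [a Dx] := halves x; have [b Dy] := halves y; have [c Dz] := halves z.
rewrite -Q in n8; clear -n8 Dx Dy Dz; move: n8.
by case: ifP; case: Dx => ->; case: Dy => ->; case: Dz => ->; lia.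
Qed.

Lemma three_squares (n : int) :
  0 < n -> (n %% 4)%Z \in [:: 1; 2] \/ (n %% 8)%Z = 3 ->
  exists u v w : int, n = u * u + v * v + w * w.
Proof.
move=> n0 n_mod; apply: three_squares_of_class_coef; first by lia.
by case: n_mod => n_mod; [exact: class_coef_neq0_12 | exact: class_coef_neq0_3].
Qed.

(** * Square values of the linear forms *)

Definition good (a b c d K : int) (p : int * int * int) : bool :=
  let: (u, v, w) := p in
  let S := a * a + b * b + c * c + d * d in
  [&& (S %| a * K + b * u + c * v + d * w)%Z,
      (S %| b * K - a * u - d * v + c * w)%Z,
      (S %| c * K + d * u - a * v - b * w)%Z &
      (S %| d * K - c * u + b * v - a * w)%Z].

(* With beta = K + ui + vj + wk and alpha = a + bi + cj + dk, the solution is the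
   quaternion conj(beta) * alpha / S. *)
Lemma good_solution (a b c d K u v w m : int) :
  let S := a * a + b * b + c * c + d * d in
  S != 0 -> S * m = K * K + (u * u + v * v + w * w) -> good a b c d K (u, v, w) ->
  exists x y z t : int, m = x ^+ 2 + y ^+ 2 + z ^+ 2 + t ^+ 2 /\
    a * x + b * y + c * z + d * t = K.
Proof.
move=> S S0 Sm; rewrite /good -/S.
case/and4P=> /dvdzP[x Dx] /dvdzP[y Dy] /dvdzP[z Dz] /dvdzP[t Dt].
exists x, y, z, t; split; last first.
  apply: (mulIf S0).
  rewrite (_ : _ * S = a * (x * S) + b * (y * S) + c * (z * S) + d * (t * S)); last by ring.
  by rewrite -Dx -Dy -Dz -Dt /S; ring.
apply: (mulfI (mulf_neq0 S0 S0)).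
rewrite (_ : S * S * (x ^+ 2 + y ^+ 2 + z ^+ 2 + t ^+ 2) =
  (x * S) ^+ 2 + (y * S) ^+ 2 + (z * S) ^+ 2 + (t * S) ^+ 2); last by ring.
by rewrite -mulrA Sm -Dx -Dy -Dz -Dt /S; ring.
Qed.

Definition signs : seq (int * int * int) :=
  [:: (1, 1, 1); (1, 1, -1); (1, -1, 1); (1, -1, -1);
      (-1, 1, 1); (-1, 1, -1); (-1, -1, 1); (-1, -1, -1)].

Definition signed_perm (i : nat) (e p : int * int * int) : int * int * int :=
  let: (u, v, w) := p in let: (e1, e2, e3) := e in
  match i with
  | 0 => (e1 * u, e2 * v, e3 * w)
  | 1 => (e1 * u, e2 * w, e3 * v)
  | 2 => (e1 * v, e2 * u, e3 * w)
  | 3 => (e1 * v, e2 * w, e3 * u)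
  | 4 => (e1 * w, e2 * u, e3 * v)
  | _ => (e1 * w, e2 * v, e3 * u)
  end.

Definition norm3 (p : int * int * int) : int :=
  let: (u, v, w) := p in u * u + v * v + w * w.

Lemma signsP e1 e2 e3 : (e1, e2, e3) \in signs -> [/\ e1 * e1 = 1, e2 * e2 = 1 & e3 * e3 = 1].
Proof.
by rewrite !inE => H; repeat case/orP: H => [/eqP[-> -> ->]//|H]; case/eqP: H => -> -> ->.
Qed.

Lemma norm3_signed_perm i e p : e \in signs -> norm3 (signed_perm i e p) = norm3 p.
Proof.
case: e => [[e1 e2] e3] /signsP[h1 h2 h3]; case: p => [[u v] w].
have sq (e' x : int) : e' * e' = 1 -> (e' * x) * (e' * x) = x * x.
  by move=> E; rewrite mulrACA E mul1r.
by case: i => [|[|[|[|[|i]]]]] /=; rewrite !sq //; ring.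
Qed.

(** * Finite checks on residues *)

Definition some_good (a b c d K : int) (p : int * int * int) : bool :=
  has (fun i => has (fun e => good a b c d K (signed_perm i e p)) signs) (iota 0 6).

(* Three times the reflection of p in the plane orthogonal to (1, 1, 1). *)
Definition reflect3 (p : int * int * int) : int * int * int :=
  let: (u, v, w) := p in
  let s := u + v + w in (3 * u - 2 * s, 3 * v - 2 * s, 3 * w - 2 * s).

(** The signs that make u + v + w divisible by 3 are not visible mod S, so the reflection must
    succeed for all of them. It is taken with the factor 3, which is invertible mod S. Conditionals
    keep [vm_compute] from evaluating the costly branches. *)
Definition residue_check (refl : bool) (a b c d K u v w : int) : bool :=
  let S := a * a + b * b + c * c + d * d in
  if (S %| K * K + (u * u + v * v + w * w))%Z then
    if some_good a b c d K (u, v, w) then true else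
    if refl then
      all (fun e => some_good a b c d (3 * K) (reflect3 (signed_perm 0 e (u, v, w)))) signs
    else false
  else true.

Definition residues_check (refl : bool) (a b c d : int) (r ks : seq int) : bool :=
  all (fun k => all (fun u => all (fun v => all (fun w =>
    residue_check refl a b c d (k * k) u v w) r) r) r) ks.

Definition zrange (n : nat) : seq int := [seq Posz i | i <- iota 0 n].

Lemma mem_zrange n (x : int) : (x \in zrange n) = (0 <= x < n%:Z).
Proof.
apply/mapP/idP => [[i]|xn]; first by rewrite mem_iota => ? ->; lia.
by exists (absz x); [rewrite mem_iota|]; lia.
Qed.

(** These n are 4^j l with j <= 2 and l = 1, 2 mod 4 or l = 3 mod 8, except that j = 2 with l = 3
    mod 8 is left out: it would need the modulus 128 instead of 64. *)
Definition ok2 (n : int) : bool :=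
  [|| (n %% 4 == 1)%Z, (n %% 4 == 2)%Z, (n %% 8 == 3)%Z, (n %% 16 == 4)%Z,
      (n %% 16 == 8)%Z, (n %% 32 == 12)%Z, (n %% 64 == 16)%Z | (n %% 64 == 32)%Z].

Lemma three_squares_ok2 (n : int) : 0 < n -> ok2 n -> exists u v w : int, n = norm3 (u, v, w).
Proof.
move=> n0 n_ok.
have quadruple (l : int) : n = 4 * l -> (exists u v w : int, l = norm3 (u, v, w)) ->
    exists u v w : int, n = norm3 (u, v, w).
  by move=> -> [u [v [w ->]]]; exists (2 * u), (2 * v), (2 * w); rewrite /=; ring.
have base (l : int) : 0 < l -> (l %% 4)%Z = 1 \/ (l %% 4)%Z = 2 \/ (l %% 8)%Z = 3 ->
    exists u v w : int, l = norm3 (u, v, w).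
  by move=> l0 [l4|[l4|l8]]; apply: three_squares => //; rewrite ?inE ?l4; [left|left|right].
have [n4|n4] : (n %% 4)%Z = 0 \/ (n %% 4)%Z <> 0 by lia.
  apply: (quadruple (n %/ 4)%Z); first by lia.
  have [n16|n16] : (n %% 16)%Z = 0 \/ (n %% 16)%Z <> 0 by lia.
    have [u [v [w E]]] : exists u v w : int, (n %/ 16)%Z = norm3 (u, v, w).
      by apply: base; [lia | clear -n_ok n16; move: n_ok; rewrite /ok2; lia].
    by exists (2 * u), (2 * v), (2 * w); move: E; rewrite /=; lia.
  by apply: base; [lia | clear -n_ok n4 n16; move: n_ok; rewrite /ok2; lia].
by apply: base => //; clear -n_ok n4; move: n_ok; rewrite /ok2; lia.
Qed.

(* n = S m - k^4 is a sum of three squares and either the reflection is integral or,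
   when halve holds, all of k^2, u, v, w are even. *)
Definition kcond (halve : bool) (k n : int) : bool :=
  ok2 n && ((n %% 3 != 1)%Z || [&& halve, (k %% 2 == 0)%Z & (n %% 4 == 0)%Z]).

(** 192 = 64 * 3 is a common modulus for [ok2] and the condition mod 3. *)
Definition choice_check (halve : bool) (S : int) (ks : seq int) : bool :=
  all (fun r => if (r %% 16 == 0)%Z then true else
    has (fun k => kcond halve k ((S * r - (k * k) * (k * k)) %% 192)%Z) ks) (zrange 192).

(** The table lists solutions whose linear form is 0. The bounds 130, 100, 77 and 45 used below are
    the least n with S n > 6^4, beyond which S m - k^4 is positive for every k in use. *)
Definition small_check (halve : bool) (a b c d : int) (ks : seq int) (n : nat)
    (table : seq (int * int * int * int)) : bool :=
  let S := a * a + b * b + c * c + d * d in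
  all (fun m => if (m %% 16 == 0)%Z then true else
    if has (fun q => let: (x, y, z, t) := q in
         (m == x * x + y * y + z * z + t * t) && (a * x + b * y + c * z + d * t == 0)) table
    then true else
    has (fun k => if (k * k) * (k * k) < S * m
      then kcond halve k ((S * m - (k * k) * (k * k)) %% 192)%Z else false) ks) (zrange n).

Lemma residues_check10 : residues_check true 1 1 2 2 (zrange 6) [:: 1; 2; 3; 4; 6].
Proof. by vm_compute. Qed.
(** Even triples with even k need no reflection, so for S = 10 they also serve when the sum of three
    squares is 1 mod 3. *)
Lemma residues_check10_even : residues_check false 1 1 2 2 [:: 0; 2; 4] [:: 2; 4; 6].
Proof. by vm_compute. Qed.
Lemma residues_check13 : residues_check true 1 2 2 2 (zrange 7) [:: 1; 2; 3; 4; 5; 6].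
Proof. by vm_compute. Qed.
Lemma residues_check17 : residues_check true 2 2 3 0 (zrange 9) [:: 1; 2; 3; 4; 5; 6].
Proof. by vm_compute. Qed.
Lemma residues_check29 : residues_check true 2 3 4 0 (zrange 15) [:: 1; 2; 3; 4; 5; 6].
Proof. by vm_compute. Qed.
Lemma choice_check10 : choice_check true 10 [:: 1; 2; 3; 4; 6].
Proof. by vm_compute. Qed.
Lemma choice_check13 : choice_check false 13 [:: 1; 2; 3; 4; 5; 6].
Proof. by vm_compute. Qed.
Lemma choice_check17 : choice_check false 17 [:: 1; 2; 3; 4; 5; 6].
Proof. by vm_compute. Qed.
Lemma choice_check29 : choice_check false 29 [:: 1; 2; 3; 4; 5; 6].
Proof. by vm_compute. Qed.
Lemma small_check13 : small_check false 1 2 2 2 [:: 1; 2; 3; 4; 5; 6] 100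
  [:: (0, -1, 0, 1); (-2, 0, 0, 1); (0, -2, 0, 2); (0, -6, 2, 4); (-6, -3, 2, 4)].
Proof. by vm_compute. Qed.
Lemma small_check10 : small_check true 1 1 2 2 [:: 1; 2; 3; 4; 6] 130
  [:: (-2, 0, 0, 1); (-2, 2, 0, 0)].
Proof. by vm_compute. Qed.
Lemma small_check17 : small_check false 2 2 3 0 [:: 1; 2; 3; 4; 5; 6] 77
  [:: (0, 0, 0, 1); (0, 0, 0, 2); (-4, -2, 4, 2); (-6, 3, 2, 0); (-6, 0, 4, 3)].
Proof. by vm_compute. Qed.
Lemma small_check29 : small_check false 2 3 4 0 [:: 1; 2; 3; 4; 5; 6] 45
  [:: (0, 0, 0, 1); (-2, -4, 4, 2)].
Proof. by vm_compute. Qed.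

(** * Translation mod S, scaling and the reflection *)

Definition shift3 (S : int) (p q : int * int * int) : int * int * int :=
  (p.1.1 + S * q.1.1, p.1.2 + S * q.1.2, p.2 + S * q.2).

Lemma good_shift a b c d K p q :
  good a b c d K p -> good a b c d K (shift3 (a * a + b * b + c * c + d * d) p q).
Proof.
case: p q => [[u v] w] [[u' v'] w']; rewrite /good /shift3 /=.
set S := a * a + b * b + c * c + d * d.
case/and4P=> /dvdzP[x Dx] /dvdzP[y Dy] /dvdzP[z Dz] /dvdzP[t Dt].
apply/and4P; split; apply/dvdzP.
- by exists (x + (b * u' + c * v' + d * w')); rewrite [RHS]mulrDl -Dx; ring.
- by exists (y + (- a * u' - d * v' + c * w')); rewrite [RHS]mulrDl -Dy; ring.
- by exists (z + (d * u' - a * v' - b * w')); rewrite [RHS]mulrDl -Dz; ring.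
- by exists (t + (- c * u' + b * v' - a * w')); rewrite [RHS]mulrDl -Dt; ring.
Qed.

Lemma signed_perm_shift i e S p q :
  signed_perm i e (shift3 S p q) = shift3 S (signed_perm i e p) (signed_perm i e q).
Proof.
case: e p q => [[e1 e2] e3] [[u v] w] [[u' v'] w'].
by case: i => [|[|[|[|[|i]]]]]; rewrite /shift3 /=; congr (_, _, _); ring.
Qed.

Lemma reflect3_shift S p q : reflect3 (shift3 S p q) = shift3 S (reflect3 p) (reflect3 q).
Proof.
by case: p q => [[u v] w] [[u' v'] w']; rewrite /shift3 /=; congr (_, _, _); ring.
Qed.

Lemma some_good_shift a b c d K p q :
  some_good a b c d K p ->
  some_good a b c d K (shift3 (a * a + b * b + c * c + d * d) p q).
Proof.
case/hasP=> i i6 /hasP[e es g]; apply/hasP; exists i => //; apply/hasP; exists e => //.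
by rewrite signed_perm_shift good_shift.
Qed.

Definition scale3 (l : int) (p : int * int * int) : int * int * int :=
  (l * p.1.1, l * p.1.2, l * p.2).

Lemma good_scale a b c d l K p :
  coprimez (a * a + b * b + c * c + d * d) l ->
  good a b c d (l * K) (scale3 l p) = good a b c d K p.
Proof.
case: p => [[u v] w] Sl; rewrite /good /scale3 /=.
set S := a * a + b * b + c * c + d * d in Sl *.
congr [&& _, _, _ & _]; rewrite -[RHS](Gauss_dvdzr _ Sl); congr (_ %| _)%Z; ring.
Qed.

Lemma signed_perm_scale i e l p :
  signed_perm i e (scale3 l p) = scale3 l (signed_perm i e p).
Proof.
case: e p => [[e1 e2] e3] [[u v] w].
by case: i => [|[|[|[|[|i]]]]]; rewrite /scale3 /=; congr (_, _, _); ring.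
Qed.

Lemma some_good_scale a b c d l K p :
  coprimez (a * a + b * b + c * c + d * d) l ->
  some_good a b c d (l * K) (scale3 l p) -> some_good a b c d K p.
Proof.
move=> Sl /hasP[i i6 /hasP[e es g]]; apply/hasP; exists i => //; apply/hasP; exists e => //.
by rewrite -(good_scale _ _ Sl) -signed_perm_scale.
Qed.

Lemma some_good_solution (a b c d K m : int) p :
  a * a + b * b + c * c + d * d != 0 ->
  (a * a + b * b + c * c + d * d) * m = K * K + norm3 p -> some_good a b c d K p ->
  exists x y z t : int, m = x ^+ 2 + y ^+ 2 + z ^+ 2 + t ^+ 2 /\
    a * x + b * y + c * z + d * t = K.
Proof.
move=> S0 Sm /hasP[i _ /hasP[e es]]; rewrite -(norm3_signed_perm i p es) in Sm.
by case: (signed_perm i e p) Sm => [[u v] w]; apply: good_solution.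
Qed.

(** Exactly one coordinate prime to 3 would give 1 mod 3. With none, two or three such coordinates,
    signs can be chosen to cancel the sum mod 3. *)
Lemma sum3_signs (u v w : int) : ((u * u + v * v + w * w) %% 3)%Z != 1 ->
  exists e s, e \in signs /\
    let: (u', v', w') := signed_perm 0 e (u, v, w) in u' + v' + w' = 3 * s.
Proof.
move=> n3.
suff [E|[E|[E|E]]] : ((u + v + w) %% 3)%Z = 0 \/ ((u + v - w) %% 3)%Z = 0 \/
    ((u - v + w) %% 3)%Z = 0 \/ ((- u + v + w) %% 3)%Z = 0.
- by exists (1, 1, 1), ((u + v + w) %/ 3)%Z; split=> //=; lia.
- by exists (1, 1, -1), ((u + v - w) %/ 3)%Z; split=> //=; lia.
- by exists (1, -1, 1), ((u - v + w) %/ 3)%Z; split=> //=; lia.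
- by exists (-1, 1, 1), ((- u + v + w) %/ 3)%Z; split=> //=; lia.
have thirds (x : int) : exists q, x = 3 * q \/ x = 3 * q + 1 \/ x = 3 * q + 2.
  by exists (x %/ 3)%Z; lia.
have [i Du] := thirds u; have [j Dv] := thirds v; have [l Dw] := thirds w.
clear thirds; move: n3.
by case: Du => [|[|]] ->; case: Dv => [|[|]] ->; case: Dw => [|[|]] ->; lia.
Qed.

(** Up to signs the triple is congruent mod S to one that was checked. If no signed permutation
    works, the reflection [p3] does: it is integral by [sum3_signs] and preserves the norm. *)
Lemma residue_solution refl r (a b c d k u v w m : int) :
  let S := a * a + b * b + c * c + d * d in
  S != 0 -> residues_check refl a b c d r [:: k] ->
  (refl -> coprimez S 3 /\ ((u * u + v * v + w * w) %% 3)%Z != 1) ->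
  (forall x, x \in [:: u; v; w] -> exists e x0 q,
     [/\ e = 1 \/ e = -1, x0 \in r & e * x = x0 + S * q]) ->
  S * m = (k * k) * (k * k) + (u * u + v * v + w * w) ->
  exists x y z t : int, m = x ^+ 2 + y ^+ 2 + z ^+ 2 + t ^+ 2 /\
    a * x + b * y + c * z + d * t = k * k.
Proof.
move=> S S0 check refl3 res Sm.
have /res[e1 [u0 [q1 [s1 ru Du]]]] : u \in [:: u; v; w] by rewrite inE eqxx.
have /res[e2 [v0 [q2 [s2 rv Dv]]]] : v \in [:: u; v; w] by rewrite !inE eqxx orbT.
have /res[e3 [w0 [q3 [s3 rw Dw]]]] : w \in [:: u; v; w] by rewrite !inE eqxx !orbT.
have es : (e1, e2, e3) \in signs.
  by case: s1 => ->; case: s2 => ->; case: s3 => ->.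
pose p0 := (u0, v0, w0); pose q := (q1, q2, q3).
pose p1 := signed_perm 0 (e1, e2, e3) (u, v, w).
have Dp1 : p1 = shift3 S p0 q by rewrite /p1 /shift3 /= Du Dv Dw.
have Np1 : norm3 p1 = u * u + v * v + w * w by rewrite norm3_signed_perm.
rewrite -Np1 in Sm refl3.
have {check} : residue_check refl a b c d (k * k) u0 v0 w0.
  have /andP[/allP/(_ _ ru)/allP/(_ _ rv)/allP/(_ _ rw) //] := check.
rewrite /residue_check -/S -/p0.
have -> : (S %| k * k * (k * k) + (u0 * u0 + v0 * v0 + w0 * w0))%Z.
  apply/dvdzP; exists (m - (2 * u0 * q1 + 2 * v0 * q2 + 2 * w0 * q3 +
    S * (q1 * q1 + q2 * q2 + q3 * q3))).
  rewrite mulrBl [m * S]mulrC Sm Dp1 /=; ring.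
case: ifP => [good0 _|_].
  by apply: (some_good_solution S0 Sm); rewrite Dp1 some_good_shift.
case: refl refl3 => [/(_ isT)[S3 n3]|//] /allP check.
have [e [s [e_signs]]] : exists e s, e \in signs /\
    let: (u', v', w') := signed_perm 0 e p1 in u' + v' + w' = 3 * s.
  exact: sum3_signs.
case Dp2: (signed_perm 0 e p1) => [[u2 v2] w2] sum3.
pose p3 := (u2 - 2 * s, v2 - 2 * s, w2 - 2 * s).
have Dp3 : scale3 3 p3 = reflect3 (signed_perm 0 e p1).
  by rewrite Dp2 /scale3 /= sum3; congr (_, _, _); ring.
have Np3 : norm3 p3 = norm3 p1.
  rewrite -(norm3_signed_perm 0 p1 e_signs) Dp2 /=.
  transitivity (u2 * u2 + v2 * v2 + w2 * w2 - 4 * s * (u2 + v2 + w2) + 12 * s * s).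
    by ring.
  by rewrite sum3; ring.
rewrite -Np3 in Sm; apply: (some_good_solution S0 Sm).
(* The check applies to three times the reflection of the residues, and 3 can be cancelled mod S. *)
apply: (some_good_scale S3); rewrite Dp3 Dp1 signed_perm_shift reflect3_shift.
exact/some_good_shift/check.
Qed.

Lemma zrange_residue (S x : int) (h : nat) : 0 < S -> S < 2 * h%:Z ->
  exists e x0 q, [/\ e = 1 \/ e = -1, x0 \in zrange h & e * x = x0 + S * q].
Proof.
move=> S0 Sh; have x_lt := ltz_pmod x S0; have x_ge := modz_ge0 x (lt0r_neq0 S0).
have Dx := divz_eq x S; case: (ltrP (x %% S)%Z h%:Z) => xh.
  exists 1, (x %% S)%Z, (x %/ S)%Z; split; [by left | by rewrite mem_zrange x_ge |].
  by rewrite mul1r {1}Dx mulrC addrC.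
exists (-1), (S - (x %% S)%Z), (- (x %/ S)%Z - 1); split; first by right.
  by rewrite mem_zrange; lia.
by rewrite {1}Dx; ring.
Qed.

Lemma kcond_mod halve k (n : int) : kcond halve k (n %% 192)%Z = kcond halve k n.
Proof.
rewrite /kcond /ok2.
have -> : ((n %% 192)%Z %% 4)%Z = (n %% 4)%Z by lia.
have -> : ((n %% 192)%Z %% 8)%Z = (n %% 8)%Z by lia.
have -> : ((n %% 192)%Z %% 16)%Z = (n %% 16)%Z by lia.
have -> : ((n %% 192)%Z %% 32)%Z = (n %% 32)%Z by lia.
have -> : ((n %% 192)%Z %% 64)%Z = (n %% 64)%Z by lia.
by have -> : ((n %% 192)%Z %% 3)%Z = (n %% 3)%Z by lia.
Qed.

(** * From the checks to all m *)

Definition represented (a b c d m : int) : Prop :=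
  exists x y z t : int, m = x ^+ 2 + y ^+ 2 + z ^+ 2 + t ^+ 2 /\
    exists k : int, a * x + b * y + c * z + d * t = k ^+ 2.

Lemma represented_of_checks (halve : bool) (a b c d : int) (h n : nat) (ks : seq int) table :
  let S := a * a + b * b + c * c + d * d in
  0 < S -> S < 2 * h%:Z -> coprimez S 3 -> 1296 < S * n%:Z ->
  all (fun k => `|k| <= 6) ks -> (halve -> S = 10) ->
  residues_check true a b c d (zrange h) ks ->
  (halve -> residues_check false a b c d [:: 0; 2; 4] [seq k <- ks | (k %% 2 == 0)%Z]) ->
  choice_check halve S ks -> small_check halve a b c d ks n table ->
  forall m : int, 0 <= m -> (m %% 16)%Z != 0 -> represented a b c d m.
Proof.
move=> S S0 Sh S3 Sn /allP ks6 S10 /allP check even_check /allP choice /allP small m m0 m16.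
suff [|[k [kks k4 kc]]] : has (fun q => let: (x, y, z, t) := q in
         (m == x * x + y * y + z * z + t * t) && (a * x + b * y + c * z + d * t == 0)) table
    \/ exists k, [/\ k \in ks, (k * k) * (k * k) < S * m & kcond halve k (S * m - (k * k) * (k * k))].
- case/hasP=> -[[[x y] z] t] _ /andP[/eqP -> /eqP L0].
  by exists x, y, z, t; split; [rewrite !expr2 | exists 0; rewrite L0].
- set N := S * m - _ in kc; have N0 : 0 < N by rewrite subr_gt0.
  have /andP[N_ok N_cond] := kc.
  have [u [v [w DN]]] := three_squares_ok2 N0 N_ok.
  have Sm : S * m = (k * k) * (k * k) + (u * u + v * v + w * w).
    by rewrite -[u * u + _ + _]/(norm3 (u, v, w)) -DN /N; ring.
  have SN0 : S != 0 by rewrite gt_eqF.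
  suff [x [y [z [t [Dm L]]]]] : exists x y z t : int,
      m = x ^+ 2 + y ^+ 2 + z ^+ 2 + t ^+ 2 /\ a * x + b * y + c * z + d * t = k * k.
    by exists x, y, z, t; split=> //; exists k; rewrite expr2.
  case/orP: N_cond => [n3|/and3P[hv k2 n4]].
    apply: (residue_solution SN0 _ _ _ Sm (refl := true) (r := zrange h)).
    + by rewrite /residues_check /= andbT; apply: check.
    + by move=> _; split=> //; rewrite -[u * u + _ + _]/(norm3 (u, v, w)) -DN.
    + by move=> x _; apply: zrange_residue.
  apply: (residue_solution SN0 _ _ _ Sm (refl := false) (r := [:: 0; 2; 4])) => //.
    rewrite /residues_check /= andbT; apply: (allP (even_check hv)).
    by rewrite mem_filter k2.
  move=> x xuvw.
  (* A sum of three squares divisible by 4 has all its terms even. *)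
  have x2 : (x %% 2)%Z = 0.
    have [i Du] := halves u; have [j Dv] := halves v; have [l Dw] := halves w.
    move: n4; rewrite DN /=; move: xuvw; rewrite !inE; clear -Du Dv Dw.
    by case: Du => ->; case: Dv => ->; case: Dw => -> /or3P[] /eqP ->; lia.
  rewrite -/S (S10 hv); clear -x2.
  have [h5|h5] : (x %% 10)%Z <= 4 \/ (x %% 10)%Z > 4 by lia.
    exists 1, (x %% 10)%Z, (x %/ 10)%Z; split; [by left | by rewrite !inE; lia | by lia].
  exists (-1), (10 - (x %% 10)%Z), (- (x %/ 10)%Z - 1).
  by split; [by right | by rewrite !inE; lia | by lia].
case: (ltrP m n%:Z) => mn.
  have := small m; rewrite mem_zrange m0 mn (negbTE m16) -/S => /(_ isT).
  case: ifP => [hq _|_ /hasP[k kks]]; first by left.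
  by case: ifP => // k4; rewrite kcond_mod => kc; right; exists k.
right; have := choice (m %% 192)%Z; rewrite mem_zrange.
have -> : 0 <= (m %% 192)%Z < 192 by lia.
have -> : ((m %% 192)%Z %% 16)%Z = (m %% 16)%Z by lia.
rewrite (negbTE m16) => /(_ isT)/hasP[k kks kc]; exists k; split=> //.
  have k6 := ks6 k kks.
  have k2 : k * k <= 36 by nia.
  have k4 : (k * k) * (k * k) <= 1296 by nia.
  by apply: (le_lt_trans k4); apply: (lt_le_trans Sn); rewrite ler_pM2l.
rewrite -kcond_mod.
rewrite (_ : (S * m - k * k * (k * k)) =
  (S * (m %/ 192)%Z) * 192 + (S * (m %% 192)%Z - k * k * (k * k))); last first.
  by rewrite {1}(divz_eq m 192); ring.
by rewrite modzMDl.
Qed.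

(** Multiplying a solution by 4 multiplies m by 16 and the linear form by the square 4, so multiples
    of 16 reduce to smaller m. *)
Lemma represented_descent (a b c d : int) :
  (forall m : int, 0 <= m -> (m %% 16)%Z != 0 -> represented a b c d m) ->
  forall m : nat, represented a b c d m%:Z.
Proof.
move=> rep; elim/ltn_ind => m IHm.
case: (eqVneq (m%:Z %% 16)%Z 0) => [m16|/rep]; last by apply.
case: (posnP m) => [->|m0].
  by exists 0, 0, 0, 0; split=> //; exists 0; rewrite !mulr0 !addr0.
have [x [y [z [t [Dm [k Dk]]]]]] := IHm (m %/ 16)%N ltac:(lia).
exists (4 * x), (4 * y), (4 * z), (4 * t); split.
  have -> : m%:Z = 16 * (m %/ 16)%N%:Z by lia.
  by rewrite Dm; ring.
exists (2 * k); rewrite exprMn -Dk; ring.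
Qed.

Theorem theorem1p3 (a b c d : int)
    (habcd : (a, b, c, d) \in
       [:: (1, 1, 2, 2); (1, 2, 2, 2); (2, 2, 3, 0); (2, 3, 4, 0)])
    (m : nat) :
  exists x y z t : int,
    m%:Z = x ^+ 2 + y ^+ 2 + z ^+ 2 + t ^+ 2 /\
    exists k : int, a * x + b * y + c * z + d * t = k ^+ 2.
Proof.
apply: represented_descent; move: habcd; rewrite !inE.
case/or4P => /eqP[-> -> -> ->].
- by apply: (represented_of_checks _ _ _ _ _ _ residues_check10
    (fun=> residues_check10_even) choice_check10 small_check10).
- by apply: (represented_of_checks _ _ _ _ _ _ residues_check13 _ choice_check13 small_check13).
- by apply: (represented_of_checks _ _ _ _ _ _ residues_check17 _ choice_check17 small_check17).
- by apply: (represented_of_checks _ _ _ _ _ _ residues_check29 _ choice_check29 small_check29).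
Qed.
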